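(* Let $n\ge 2$ and $p\ge 2$ be integers. Set $C:=\begin{bmatrix}0&1\\1&1\end{bmatrix}$ and $J:=\begin{bmatrix}0&1\\0&0\end{bmatrix}$ in $\mathrm{M}_2(\mathbb{F}_2)$, and define the affine spaces $$\mathcal{F}_2:=\left\{\begin{bmatrix} a+1&a&c\\ d&a+1&a\end{bmatrix} : (a,c,d)\in(\mathbb{F}_2)^3\right\}$$ and $$\mathcal{F}_3:=\left\{\begin{bmatrix} a&d&e\\ a+b+1&a+b&f\\ c&a+b+1&b\end{bmatrix} : (a,b,c,d,e,f)\in(\mathbb{F}_2)^6\right\}.$$ (i) If $n\ge3$ and $p\ge3$, then up to equivalence there are exactly five affine subspaces of $\mathrm{M}_{n,p}(\mathbb{F}_2)$ with codimension $3$ and lower-rank $2$: $i_{n,p}(I_2+\mathbb{F}_2C)$, $i_{n,p}(I_2+\mathbb{F}_2J)$, $i_{n,p}(\mathcal{F}_2)$, $i_{n,p}(\mathcal{F}_2^T)$ and $i_{n,p}(\mathcal{F}_3)$. (ii) If $n\ge3$ and $p=2$, then up to equivalence there are exactly three affine subspaces of $\mathrm{M}_{n,p}(\mathbb{F}_2)$ with codimension $3$ and lower-rank $2$: $i_{n,p}(I_2+\mathbb{F}_2C)$, $i_{n,p}(I_2+\mathbb{F}_2J)$ and $i_{n,p}(\mathcal{F}_2^T)$. (iii) If $n=2$ and $p\ge3$, then up to equivalence there are exactly three affine subspaces of $\mathrm{M}_{n,p}(\mathbb{F}_2)$ with codimension $3$ and lower-rank $2$: $i_{n,p}(I_2+\mathbb{F}_2C)$,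 $i_{n,p}(I_2+\mathbb{F}_2J)$ and $i_{n,p}(\mathcal{F}_2)$. (iv) Up to equivalence, $I_2+\mathbb{F}_2C$ and $I_2+\mathbb{F}_2J$ are the sole affine subspaces of $\mathrm{M}_2(\mathbb{F}_2)$ with codimension $3$ and lower-rank $2$.
   Context: $\mathrm{M}_{n,p}(\mathbb{F}_2)$ is the space of $n\times p$ matrices over $\mathbb{F}_2$. The lower-rank of a non-empty subset $\mathcal{V}$ of $\mathrm{M}_{n,p}(\mathbb{F}_2)$ is $\min\{\operatorname{rk}M : M\in\mathcal{V}\}$. Two subspaces $\mathcal{V},\mathcal{V}'$ of $\mathrm{M}_{n,p}(\mathbb{F}_2)$ (linear or affine) are equivalent when $\mathcal{V}'=P\,\mathcal{V}\,Q^{-1}$ for some $P\in\mathrm{GL}_n(\mathbb{F}_2)$ and $Q\in\mathrm{GL}_p(\mathbb{F}_2)$. For $n'\le n$, $p'\le p$ and a subset $\mathcal{X}$ of $\mathrm{M}_{n',p'}(\mathbb{F}_2)$, $i_{n,p}(\mathcal{X})$ denotes the set of all matrices of $\mathrm{M}_{n,p}(\mathbb{F}_2)$ whose upper-left $n'\times p'$ block belongs to $\mathcal{X}$ (all the other entries being arbitrary). $\mathcal{X}^T$ denotes the set of transposes of the matrices of $\mathcal{X}$. The codimension of an affine subspace is the codimension of its translation vector space. *)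

(* Defs.v *)
From HB Require Import structures.
From mathcomp Require Import all_boot all_order all_algebra.

Set Implicit Arguments.
Unset Strict Implicit.
Unset Printing Implicit Defensive.

Import GRing.Theory.

Local Open Scope ring_scope.

Section Affine.

Variables n p : nat.
Implicit Types (S : {set 'M['F_2]_(n, p)}) (V : {vspace 'M['F_2]_(n, p)}).

Definition translate (A : 'M['F_2]_(n, p)) V : {set 'M['F_2]_(n, p)} :=
  [set A + M | M in V].

Definition codim V : nat := (\dim {:'M['F_2]_(n, p)} - \dim V)%N.

Definition affine_of_codim (k : nat) S : Prop :=
  exists A V, S = translate A V /\ codim V = k.

Definition has_lower_rank (r : nat) S : Prop :=
  (exists2 M, M \in S & \rank M = r) /\
  (forall M, M \in S -> (r <= \rank M)%N).

Definition equivalent S S' : Prop :=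
  exists (P : 'M['F_2]_n) (Q : 'M['F_2]_p),
    [/\ P \in unitmx, Q \in unitmx & S' = [set P *m M *m invmx Q | M in S]].

(* The entries of s are representatives, without repetition, of the classes
   of the sets satisfying K; hence there are exactly size s classes. *)
Definition exactly_up_to_equivalence
    (K : {set 'M['F_2]_(n, p)} -> Prop) (s : seq {set 'M['F_2]_(n, p)}) :=
  [/\ forall S, S \in s -> K S,
      forall S, K S -> exists2 S', S' \in s & equivalent S S'
    & forall i j, (i < size s)%N -> (j < size s)%N ->
        equivalent (nth set0 s i) (nth set0 s j) -> i = j].

Definition codim3_lower_rank2 S : Prop :=
  affine_of_codim 3 S /\ has_lower_rank 2 S.

End Affine.

(* i_{n,p}(X); the dimensions n and p are read off from the proofs of
   n' <= n and p' <= p. *)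
Definition corner_ext (n' p' n p : nat) (hn : (n' <= n)%N) (hp : (p' <= p)%N)
    (X : {set 'M['F_2]_(n', p')}) : {set 'M['F_2]_(n, p)} :=
  [set M | mxsub (widen_ord hn) (widen_ord hp) M \in X].

Definition trset (n p : nat) (X : {set 'M['F_2]_(n, p)}) :
    {set 'M['F_2]_(p, n)} :=
  [set M^T | M in X].

Definition mx_of_rows (n p : nat) (s : seq (seq 'F_2)) : 'M['F_2]_(n, p) :=
  \matrix_(i < n, j < p) nth 0 (nth [::] s i) j.

Definition Cmx : 'M['F_2]_2 :=
  mx_of_rows 2 2 [:: [:: 0; 1];
                     [:: 1; 1]].

Definition Jmx : 'M['F_2]_2 :=
  mx_of_rows 2 2 [:: [:: 0; 1];
                     [:: 0; 0]].

Definition id_line (N : 'M['F_2]_2) : {set 'M['F_2]_2} :=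
  [set 1%:M + a *: N | a : 'F_2].

Definition calF2 : {set 'M['F_2]_(2, 3)} :=
  [set M | [exists a : 'F_2, exists c : 'F_2, exists d : 'F_2,
    M == mx_of_rows 2 3 [:: [:: a + 1; a;     c];
                            [:: d;     a + 1; a]]]].

Definition calF3 : {set 'M['F_2]_3} :=
  [set M | [exists a : 'F_2, exists b : 'F_2, exists c : 'F_2,
            exists d : 'F_2, exists e : 'F_2, exists f : 'F_2,
    M == mx_of_rows 3 3 [:: [:: a;         d;         e];
                            [:: a + b + 1; a + b;     f];
                            [:: c;         a + b + 1; b]]]].

(* Main.v *)
From HB Require Import structures.
Require Import Defs.
From mathcomp Require Import all_boot all_order all_algebra.
From mathcomp Require Import mxabelem zify.

(** Trace duality turns the question into one about four matrices.  An affine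
    space S of codimension 3 that misses 0 is cut out by three equations
    tr(N_i M) = 1; adding them up gives a fourth one, tr(N_4 M) = 1 with
    N_4 = N_1 + N_2 + N_3, and the four matrices, whose sum is 0, play
    symmetric roles.  The rank-one matrix y x belongs to S exactly when
    x N_i y = 1 for all i, and for a given row x such a y exists unless some
    x N_i vanishes (row_annihilated).  So S has no matrix of rank at most 1
    exactly when the four left kernels of the N_i cover the whole space of rows.

    Over F_2 such a cover is very constrained: a subspace of codimension r
    contains only the fraction 2^-r of all rows.  Counting nonzero rows gives one
    N_i of rank 1, and counting the rows of the affine hyperplane outside its
    kernel gives a second one with another kernel (exists_rank1,
    exists_second_rank1).  Write them u1 v1 and u2 v2.  On the rows x with
    x u1 = x u2 = 1 one has x N_3 + x N_4 = v1 + v2, and one of x N_3, x N_4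
    is 0, so x N_3 takes only the values 0 and v1 + v2.  This forces
    N_3 = (u1 + u2) a + w (v1 + v2) (two_valued_factor), that is, S consists of
    the M with v1 M u1 = 1, v2 M u2 = 1 and a M (u1 + u2) + (v1 + v2) M w = 1:
    the normal_form below.

    Only the linear dependencies among (v1, v2, a) and among (u1, u2, w) matter
    up to equivalence.  Exchanging N_3 and N_4 moves (a, w) to
    (a + v2, w + u1) or (a + v1, w + u2), and this reduces every case to five
    kinds (normal_form_kindP), each of which is a single orbit, represented by
    one of the five spaces of the theorem.

    To tell these apart, consider the pairs (y, x) such that S is invariant under
    translation by y x.  Equivalence carries these pairs over, so it preserves
    their number, the number of y that occur with every x, and the number of x
    that occur with every y.  The last two numbers separate all the spaces but
    those of C and J, where the first one decides: the line spanned by the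
    invertible C contains no matrix of rank 1, and the one spanned by J does. *)

Set Implicit Arguments.
Unset Strict Implicit.
Unset Printing Implicit Defensive.

Import GRing.Theory.
Local Open Scope ring_scope.

(** * Linear algebra over F_2 *)

Lemma F2P (x : 'F_2) : {x = 0} + {x = 1}.
Proof. by case: x => [[|[|//]] ltx2]; [left | right]; apply: val_inj. Qed.

Ltac case_F2 x := let E := fresh in case: (F2P x) => E; rewrite ?E {E}.

Lemma F2_neq0 (x : 'F_2) : (x != 0) = (x == 1).
Proof. by case_F2 x. Qed.

Lemma addff (V : lmodType 'F_2) (x : V) : x + x = 0.
Proof.
have two0 : 1 + 1 = 0 :> 'F_2 by apply/eqP.
by rewrite -[x]scale1r -scalerDl two0 scale0r.
Qed.

Lemma oppff (V : lmodType 'F_2) (x : V) : - x = x.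
Proof. by apply/esym/eqP; rewrite -addr_eq0 addff. Qed.

Lemma addff_eq0 (V : lmodType 'F_2) (x y : V) : (x + y == 0) = (x == y).
Proof. by rewrite addr_eq0 oppff. Qed.

(** The Fredholm alternative: membership in the row space of A^T is tested by
    the cokernel of A^T, whose columns are the left annihilators of A. *)
Lemma mulmx_solvable (F : fieldType) k m (A : 'M[F]_(k, m)) (t : 'cV_k) :
  (forall c : 'rV_k, c *m A = 0 -> c *m t = 0) -> exists y, A *m y = t.
Proof.
move=> annA.
have: (t^T <= A^T)%MS.
  rewrite submxE; apply/eqP/trmx_inj; rewrite trmx_mul trmxK trmx0.
  apply/row_matrixP => i; rewrite row_mul row0 annA //.
  by rewrite -row_mul -[X in _ *m X]trmxK -trmx_mul mulmx_coker trmx0 row0.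
case/submxP=> D defD; exists D^T.
by apply: trmx_inj; rewrite trmx_mul trmxK defD.
Qed.

Lemma row_basis_change (F : fieldType) k m (A B : 'M[F]_(k, m)) :
  row_free A -> row_free B -> exists2 g, g \in unitmx & A *m g = B.
Proof.
move=> freeA freeB.
have AfB : A *m (pinvmx A *m B) = B by rewrite mulmxA mulmxVp // mul1mx.
have [|g unit_g defB] := @complete_unitmx _ _ _ A (pinvmx A *m B).
  by rewrite AfB (eqP freeA) (eqP freeB).
by exists g => //; rewrite -defB.
Qed.

Lemma rank_le1 (F : fieldType) m n (A : 'M[F]_(m, n)) :
  (\rank A <= 1)%N -> exists (y : 'cV_m) (x : 'rV_n), A = y *m x.
Proof.
rewrite -{2}(mulmx_base A).
move: (col_base A) (row_base A); move: (\rank A) => [|[|//]] C R _.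
  by exists 0, 0; rewrite mul0mx; apply/matrixP=> i j; rewrite !mxE big_ord0.
by exists C, R.
Qed.

Lemma ord3_cases (i : 'I_3) : [|| i == inord 0, i == inord 1 | i == inord 2].
Proof. by rewrite -!val_eqE /= !inordK //; case: i => -[|[|[]]]. Qed.

(** * Dual equations of an affine space of codimension 3 *)

Section Dual.
Variables n p : nat.
Import VectorInternalTheory.

Lemma subspace_equations k (V : {vspace 'M['F_2]_(n, p)}) : codim V = k ->
  exists g : {linear 'M['F_2]_(n, p) -> 'rV['F_2]_k},
    forall M, (M \in V) = (g M == 0).
Proof.
move=> cV.
have : \rank (cokermx (vs2mx V)) = k.
  by rewrite mxrank_coker -cV /codim dimvf.
set K := cokermx _.
have memV M : (M \in V) = (v2r M *m col_base K == 0).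
  rewrite memvE /subsetv !genmxE submxE -/K -{1}(mulmx_base K) mulmxA.
  by rewrite -[0 in LHS](mul0mx _ (row_base K)) (inj_eq (row_free_inj (row_base_free K))).
move=> rkK; move: (col_base K) memV; rewrite rkK => C memV.
have lin : linear (fun M : 'M['F_2]_(n, p) => v2r M *m C).
  by move=> a u v; rewrite linearP mulmxDl scalemxAl.
pose L := GRing.isLinear.Build _ _ _ _ _ lin.
pose g : {linear _ -> _} := HB.pack (fun M : 'M['F_2]_(n, p) => v2r M *m C) L.
by exists g.
Qed.

Implicit Types (S : {set 'M['F_2]_(n, p)}) (s : seq 'M['F_2]_(p, n)).

(** Keeping the redundant fourth equation makes the notion invariant under all
    permutations of s. *)
Definition dual_quadruple S s :=
  [/\ size s = 4%N, \sum_(N <- s) N = 0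
    & forall M, (M \in S) = all (fun N => \tr (N *m M) == 1) s].

Lemma linear_form_trace (f : {linear 'M['F_2]_(n, p) -> ('F_2)^o}) :
  exists N : 'M['F_2]_(p, n), forall M, f M = \tr (N *m M).
Proof.
exists (\matrix_(j, i) f (delta_mx i j)) => M.
rewrite {1}[M]matrix_sum_delta linear_sum mxtrace_mulC /mxtrace.
apply: eq_bigr => i _; rewrite linear_sum mxE; apply: eq_bigr => j _.
by rewrite linearZ mxE.
Qed.

(** Three linear equations that define the direction of S take on S a constant
    value, a nonzero row of length 3; a change of basis of the equations turns
    this row into (1, 1, 1). *)
Lemma dual_quadruple_exists S :
  affine_of_codim 3 S -> 0 \notin S -> exists s, dual_quadruple S s.
Proof.
case=> A [V [-> cV]] S0; have [g memV] := subspace_equations cV.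
have memS M : (M \in translate A V) = (g M == g A).
  apply/imsetP/eqP => [[M' VM' ->]|gM].
    by rewrite linearD; move: VM'; rewrite memV => /eqP->; rewrite addr0.
  exists (M - A); last by rewrite addrC subrK.
  by rewrite memV linearB gM subrr.
have gA0 : g A != 0 by move: S0; rewrite memS linear0 eq_sym.
have free1 : row_free (const_mx 1 : 'rV['F_2]_3).
  rewrite /row_free rank_rV; suff -> : const_mx 1 != 0 :> 'rV['F_2]_3 by [].
  by apply/eqP=> /matrixP/(_ 0 0); rewrite !mxE.
have freeA : row_free (g A) by rewrite /row_free rank_rV gA0.
have [h unit_h gAh] := row_basis_change freeA free1.
have /fin_all_exists [N trN] (i : 'I_3) :
  exists N : 'M['F_2]_(p, n), forall M, (g M *m h) 0 i = \tr (N *m M).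
  have lin : linear (fun M => (g M *m h) 0 i : ('F_2)^o).
    by move=> a u v; rewrite linearP mulmxDl -scalemxAl !mxE.
  pose L := GRing.isLinear.Build _ _ _ _ _ lin.
  pose f : {linear _ -> _} := HB.pack (fun M => (g M *m h) 0 i : ('F_2)^o) L.
  exact: (linear_form_trace f).
have {}memS M : (M \in translate A V) = [forall i, \tr (N i *m M) == 1].
  rewrite memS -(inj_eq (can_inj (mulmxK unit_h))) gAh.
  apply/eqP/forallP => [gM i|trM]; first by rewrite -trN gM mxE.
  by apply/rowP => i; rewrite trN mxE; apply/eqP.
pose o (i : nat) : 'I_3 := inord i.
exists [:: N (o 0%N); N (o 1%N); N (o 2%N); N (o 0%N) + N (o 1%N) + N (o 2%N)].
split=> //.
  by rewrite !big_cons big_nil addr0 2!addrA addff.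
move=> M; rewrite memS /= andbT !mulmxDl !linearD /=.
apply/forallP/idP => [trM | /and4P[tr0 tr1 tr2 _] i].
  by rewrite !(eqP (trM _)).
case/or3P: (ord3_cases i) => /eqP->; [exact: tr0 | exact: tr1 | exact: tr2].
Qed.

(** If no x N is 0, there is y with x N y = 1 for all N: an obstruction would be
    a vanishing sum of an odd number of the first three x N, hence one of the
    four x N itself.  Then y x would be a matrix of S of rank at most 1. *)
Lemma row_annihilated S s : dual_quadruple S s ->
    (forall M, M \in S -> (2 <= \rank M)%N) ->
  forall x : 'rV_p, has (fun N => x *m N == 0) s.
Proof.
move=> [ss sum0 memS] rkS x; apply: contraT; rewrite -all_predC => /allP nz.
suff [y xy] : exists y : 'cV_n, forall N, N \in s -> (x *m N *m y) 0 0 = 1.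
  have /rkS : y *m x \in S.
    rewrite memS; apply/allP => N sN; apply/eqP.
    by rewrite mulmxA mxtrace_mulC mulmxA [_ *m y]mx11_scalar xy // mxtrace_scalar.
  by rewrite ltnNge (leq_trans (mxrankM_maxr _ _)) ?rank_leq_row.
case: s ss sum0 nz {memS} => [|N0 [|N1 [|N2 [|N3 [|]]]]] //= _.
rewrite !big_cons big_nil addr0 => /eqP; rewrite !addrA addff_eq0 => /eqP <-{N3} nz.
pose A := col_mx (x *m N0) (col_mx (x *m N1) (x *m N2)).
have [|y Ay] := @mulmx_solvable _ _ _ A (col_mx 1%:M (col_mx 1%:M 1%:M)).
  move=> c; rewrite -[c]hsubmxK -[rsubmx c]hsubmxK !mul_row_col !mulmx1.
  rewrite [lsubmx c]mx11_scalar [lsubmx (rsubmx c)]mx11_scalar [rsubmx (rsubmx c)]mx11_scalar.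
  rewrite !mul_scalar_mx.
  have nz' N : N \in [:: N0; N1; N2; N0 + N1 + N2] -> x *m N = 0 -> False.
    by move=> /nz/eqP.
  move: (lsubmx _ _ _) (lsubmx _ _ _) (rsubmx _ _ _) => c0 c1 c2.
  (* An even number of coefficients 1 annihilates the right-hand side; an odd one
     contradicts that no x N vanishes. *)
  { case_F2 c0; case_F2 c1; case_F2 c2;
    rewrite ?scale0r ?scale1r ?add0r ?addr0;
    try by move=> _; rewrite -?raddfD -(raddf0 scalar_mx) /=; congr (_%:M); apply/eqP.
  all: by rewrite -?mulmxDr ?addrA => /nz' []; rewrite !inE eqxx ?orbT. }
move: Ay; rewrite !mul_col_mx => /eq_col_mx[y0 /eq_col_mx[y1 y2]].
exists y => N; rewrite !inE => /or4P[] /eqP->; rewrite ?y0 ?y1 ?y2 ?mulmxDr ?mulmxDl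
  ?y0 ?y1 ?y2 !mxE //.
by apply/eqP.
Qed.

End Dual.

(** * Counting: two of the four matrices have rank one *)

Section Count.
Variables n p : nat.
Implicit Types (S : {set 'M['F_2]_(n, p)}) (s : seq 'M['F_2]_(p, n)).
Implicit Types N : 'M['F_2]_(p, n).

Definition lker_set N : {set 'rV['F_2]_p} := [set x | x *m N == 0].

Definition dual_hyperplane (u : 'cV['F_2]_p) : {set 'rV['F_2]_p} :=
  [set x | (x *m u) 0 0 == 1].

Lemma card_lker_set N : (#|lker_set N| * 2 ^ \rank N = 2 ^ p)%N.
Proof.
have -> : lker_set N = rowg (kermx N).
  by apply/setP=> x; rewrite inE mem_rowg sub_kermx.
by rewrite card_rowg mxrank_ker card_Fp // -expnD subnK // rank_leq_row.
Qed.

Lemma card_covered (A : {set 'rV['F_2]_p}) s :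
    (forall x, x \in A -> has (fun N => x *m N == 0) s) ->
  (#|A| <= \sum_(N <- s) #|A :&: lker_set N|)%N.
Proof.
elim: s A => [|N s IHs] A covA.
  by rewrite big_nil leqn0 cards_eq0; apply/eqP/setP=> x; rewrite inE; apply/negP=> /covA.
rewrite big_cons -(cardsID (lker_set N)) leq_add2l.
apply: leq_trans (IHs _ _) _ => [x|].
  by rewrite !inE => /andP[/negbTE nxN /covA]; rewrite /= nxN.
by rewrite leq_sum // => N' _; rewrite subset_leq_card ?setSI ?subsetDl.
Qed.

(** Translation by x0 exchanges the two halves of K. *)
Lemma card_half (K : {set 'rV['F_2]_p}) u x0 :
    (forall x y, x \in K -> y \in K -> x + y \in K) ->
  x0 \in dual_hyperplane u :&: K -> (2 * #|dual_hyperplane u :&: K| = #|K|)%N.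
Proof.
move=> addK; rewrite !inE => /andP[/eqP ux0 Kx0].
rewrite mul2n -addnn -(cardsID (dual_hyperplane u) K) setIC; congr (_ + _)%N.
rewrite -(card_imset _ (addIr x0)); apply: eq_card => x.
apply/imsetP/idP => [[y] | ].
  rewrite !inE => /andP[Ky /eqP uy] ->.
  by rewrite addK // mulmxDl mxE uy ux0.
rewrite !inE => /andP[ux Kx]; exists (x + x0); last by rewrite -addrA addff addr0.
rewrite !inE addK // mulmxDl mxE ux0.
by case: (F2P ((x *m u) 0 0)) ux => ->.
Qed.

Section LowerRankTwo.
Variables (S : {set 'M['F_2]_(n, p)}).
Hypothesis S0 : S != set0.
Hypothesis rkS : forall M, M \in S -> (2 <= \rank M)%N.

Lemma quadruple_neq0 s N : dual_quadruple S s -> N \in s -> N != 0.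
Proof.
case=> _ _ memS sN; have /set0Pn[M] := S0; rewrite memS => /allP/(_ N sN).
by apply: contraTneq => ->; rewrite mul0mx mxtrace0.
Qed.

(** Otherwise each kernel has at most 2^p / 4 rows, and the four of them, which
    share the zero row, cannot contain the 2^p - 1 nonzero rows. *)
Lemma exists_rank1 s : dual_quadruple S s -> exists2 N, N \in s & (\rank N <= 1)%N.
Proof.
move=> dS; apply/hasP; apply: contraT; rewrite -all_predC => /allP rk2.
pose A : {set 'rV['F_2]_p} := [set~ 0].
have cov : forall x : 'rV['F_2]_p, x \in A -> has (fun N => x *m N == 0) s.
  by move=> x _; exact: (row_annihilated dS rkS x).
have := card_covered cov; rewrite cardsC1 card_mx card_Fp // mul1n.
have small N : N \in s -> (4 * #|A :&: lker_set N| + 4 <= 2 ^ p)%N.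
  move=> /rk2 /=; rewrite -ltnNge => rkN.
  rewrite -(card_lker_set N) (cardsD1 0 (lker_set N)) inE mul0mx eqxx.
  have -> : A :&: lker_set N = lker_set N :\ 0 by rewrite setIC setDE.
  have le4 : (4 <= 2 ^ \rank N)%N by rewrite (@leq_exp2l 2 2).
  by apply: leq_trans (leq_mul (leqnn _) le4); rewrite mulnDl addnC (mulnC 4).
have [ss _ _] := dS.
case: s ss small {dS rk2 cov} => [|N0 [|N1 [|N2 [|N3 [|]]]]] //= _ small.
rewrite !big_cons big_nil.
have := small N0; have := small N1; have := small N2; have := small N3.
rewrite !inE !eqxx ?orbT => /(_ isT) ? /(_ isT) ? /(_ isT) ? /(_ isT) ?.
lia.
Qed.

(** Within the 2^p / 2 rows x with x u1 = 1, a kernel of codimension at least 2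
    has at most 2^p / 8 rows and the kernel of a nonzero matrix u1 v has none; three such
    sets are not enough. *)
Lemma exists_second_rank1 s (u1 : 'cV_p) (v1 : 'rV_n) : dual_quadruple S (u1 *m v1 :: s) ->
  exists N (u2 : 'cV_p) (v2 : 'rV_n), [/\ N \in s, N = u2 *m v2 & u1 != u2].
Proof.
move=> dS.
have N1nz : u1 *m v1 != 0 by apply: (quadruple_neq0 dS); rewrite mem_head.
have [x0 ux0] : exists x0, x0 \in dual_hyperplane u1.
  case: (pickP (fun i => u1 i 0 != 0)) => [i ui|u0].
    by exists (delta_mx 0 i); rewrite inE -rowE mxE -F2_neq0.
  case/eqP: N1nz; suff -> : u1 = 0 by rewrite mul0mx.
  by apply/colP => i; rewrite mxE; apply/eqP; move/negbFE: (u0 i).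
have cardA : (2 * #|dual_hyperplane u1| = 2 ^ p)%N.
  have := @card_half setT u1 x0 (fun _ _ _ _ => in_setT _).
  by rewrite setIT cardsT card_mx card_Fp // mul1n => /(_ ux0).
have empty v : u1 *m v != 0 -> #|dual_hyperplane u1 :&: lker_set (u1 *m v)| = 0%N.
  move=> nz; apply/eqP; rewrite cards_eq0; apply: contraNT nz => /set0Pn[x].
  rewrite !inE mulmxA => /andP[/eqP ux].
  by rewrite [x *m u1]mx11_scalar ux mul1mx => /eqP->; rewrite mulmx0.
have [/hasP[N sN]|] := boolP (has (fun N =>
    (\rank N <= 1)%N && (#|dual_hyperplane u1 :&: lker_set N| != 0%N)) s).
  case/andP=> /rank_le1[u2 [v2 defN]] N0; exists N, u2, v2; split=> //.
  apply: contraNneq N0 => u12; rewrite defN u12.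
  rewrite -u12 empty // u12 -defN (quadruple_neq0 dS) // inE sN orbT //.
rewrite -all_predC => /allP big.
have small N : N \in s -> (8 * #|dual_hyperplane u1 :&: lker_set N| <= 2 ^ p)%N.
  move=> /big /=; rewrite negb_and negbK -ltnNge => /orP[rkN|/eqP->]; last by rewrite muln0.
  have [->|/set0Pn[x Kx]] := eqVneq (dual_hyperplane u1 :&: lker_set N) set0.
    by rewrite cards0.
  have := card_half _ Kx; rewrite -(card_lker_set N) => <-.
    have le4 : (4 <= 2 ^ \rank N)%N by rewrite (@leq_exp2l 2 2).
    by apply: leq_trans (leq_mul (leqnn _) le4); rewrite mulnAC.
  by move=> y z; rewrite !inE mulmxDl => /eqP-> /eqP->; rewrite addr0.
have cov : forall x : 'rV['F_2]_p, x \in dual_hyperplane u1 ->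
    has (fun N => x *m N == 0) (u1 *m v1 :: s).
  by move=> x _; exact: (row_annihilated dS rkS x).
have := card_covered cov; rewrite big_cons empty // add0n.
have [ss _ _] := dS.
case: s ss small {dS big cov} => [|N0 [|N1 [|N2 [|]]]] //= _ small.
rewrite !big_cons big_nil.
have := small N0; have := small N1; have := small N2.
rewrite !inE !eqxx ?orbT => /(_ isT) le2 /(_ isT) le1 /(_ isT) le0; move: le0 le1 le2.
have: (0 < 2 ^ p)%N by rewrite expn_gt0.
rewrite -cardA; move: #|dual_hyperplane u1 :&: lker_set N0| => k0.
move: #|dual_hyperplane u1 :&: lker_set N1| => k1.
move: #|dual_hyperplane u1 :&: lker_set N2| => k2.
move: #|dual_hyperplane u1| => k.
move=> *; exfalso; lia.
Qed.

End LowerRankTwo.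
End Count.

(** * The normal form *)

Section NormalForm.
Variables n p : nat.
Implicit Types (S : {set 'M['F_2]_(n, p)}) (v a : 'rV['F_2]_n) (u w : 'cV['F_2]_p).

Definition pairing v (M : 'M['F_2]_(n, p)) u : 'F_2 := (v *m M *m u) 0 0.

Lemma pairingDl v1 v2 M u : pairing (v1 + v2) M u = pairing v1 M u + pairing v2 M u.
Proof. by rewrite /pairing !mulmxDl mxE. Qed.

Lemma pairingDr v M u1 u2 : pairing v M (u1 + u2) = pairing v M u1 + pairing v M u2.
Proof. by rewrite /pairing mulmxDr mxE. Qed.

Lemma pairing0l M u : pairing 0 M u = 0.
Proof. by rewrite /pairing !mul0mx mxE. Qed.

Lemma pairing0r v M : pairing v M 0 = 0.
Proof. by rewrite /pairing mulmx0 mxE. Qed.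

Definition pairingE := (pairingDl, pairingDr, pairing0l, pairing0r).

Lemma trace_pairing v u M : \tr (u *m v *m M) = pairing v M u.
Proof. by rewrite -mulmxA mxtrace_mulC trace_mx11. Qed.

(** The dual matrices are u1 v1, u2 v2 and (u1 + u2) a + w (v1 + v2). *)
Definition normal_form v1 v2 a u1 u2 w : {set 'M['F_2]_(n, p)} :=
  [set M | [&& pairing v1 M u1 == 1, pairing v2 M u2 == 1
             & pairing a M (u1 + u2) + pairing (v1 + v2) M w == 1]].

Lemma in_normal_form v1 v2 a u1 u2 w M :
  (M \in normal_form v1 v2 a u1 u2 w)
  = [&& pairing v1 M u1 == 1, pairing v2 M u2 == 1
      & pairing a M (u1 + u2) + pairing (v1 + v2) M w == 1].
Proof. exact: in_set. Qed.

(** The shift replaces the third dual matrix by the fourth one. *)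
Lemma normal_form_shift v1 v2 a u1 u2 w :
  normal_form v1 v2 (a + v2) u1 u2 (w + u1) = normal_form v1 v2 a u1 u2 w.
Proof.
apply/setP=> M; rewrite 2!in_normal_form !pairingE.
move: (pairing v1 M u1) (pairing v2 M u1) (pairing v2 M u2).
move: (pairing a M u1) (pairing a M u2) (pairing v1 M w) (pairing v2 M w).
move=> x1 x2 x3 x4 x5 x6 x7.
by case_F2 x5; case_F2 x6; case_F2 x7; case_F2 x1; case_F2 x2; case_F2 x3; case_F2 x4.
Qed.

Lemma normal_form_swap v1 v2 a u1 u2 w :
  normal_form v2 v1 a u2 u1 w = normal_form v1 v2 a u1 u2 w.
Proof.
apply/setP=> M; rewrite [LHS]in_normal_form [RHS]in_normal_form.
by rewrite andbCA (addrC u2 u1) (addrC v2 v1).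
Qed.

(** Any row x0 with x0 u1 = x0 u2 = 1 has x0 N in {0, d}, where d = v1 + v2, so
    x N is in {0, d} also for x in the direction u1 = u2 = 0.  After subtraction
    of the part of N seen by u1 and u2, all rows of N are thus 0 or d, whence a
    factor w d.  The remaining part u1 y1 + u2 y2 has y1 + y2 in {0, d}, and if
    this sum is d, the defect u2 d is absorbed by w. *)
Lemma two_valued_factor (N : 'M['F_2]_(p, n)) u1 u2 v1 v2 :
    u1 != 0 -> u2 != 0 -> u1 != u2 ->
    (forall x : 'rV_p, (x *m u1) 0 0 = 1 -> (x *m u2) 0 0 = 1 ->
       x *m N = 0 \/ x *m N = v1 + v2) ->
  exists a w, N = (u1 + u2) *m a + w *m (v1 + v2).
Proof.
move=> u1nz u2nz u12 two; set d := v1 + v2 in two *.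
have solve t1 t2 : exists x : 'rV_p, x *m u1 = t1%:M /\ x *m u2 = t2%:M.
  pose A := col_mx u1^T u2^T.
  have [|y] := @mulmx_solvable _ _ _ A (col_mx t1%:M t2%:M).
    move=> c; rewrite -[c]hsubmxK !mul_row_col.
    rewrite [lsubmx c]mx11_scalar [rsubmx c]mx11_scalar !mul_scalar_mx.
    move: (lsubmx _ _ _) (rsubmx _ _ _) => c1 c2.
    case_F2 c1; case_F2 c2; rewrite ?scale0r ?scale1r ?add0r ?addr0 // => /eqP.
    - by rewrite -(trmx0 _) (inj_eq trmx_inj) (negbTE u2nz).
    - by rewrite -(trmx0 _) (inj_eq trmx_inj) (negbTE u1nz).
    by rewrite addff_eq0 (inj_eq trmx_inj) (negbTE u12).
  rewrite mul_col_mx => /eq_col_mx[/(congr1 trmx) y1 /(congr1 trmx) y2].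
  exists y^T; move: y1 y2; rewrite !trmx_mul !trmxK !tr_scalar_mx.
  by [].
(* x1, x2 is dual to u1, u2 *)
have [x1 [x1u1 x1u2]] := solve 1 0; have [x2 [x2u1 x2u2]] := solve 0 1.
have {}two y : y *m u1 = 1%:M -> y *m u2 = 1%:M -> y *m N = 0 \/ y *m N = d.
  by move=> yu1 yu2; apply: two; rewrite ?yu1 ?yu2 mxE eqxx.
have sumN : (x1 + x2) *m N = 0 \/ (x1 + x2) *m N = d.
  by apply: two; rewrite mulmxDl (x1u1, x1u2) (x2u1, x2u2) -raddfD ?addr0 ?add0r.
have homN x : x *m u1 = 0 -> x *m u2 = 0 -> x *m N = 0 \/ x *m N = d.
  move=> xu1 xu2; have: (x + (x1 + x2)) *m N = 0 \/ (x + (x1 + x2)) *m N = d.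
    by apply: two; rewrite !mulmxDl (xu1, xu2) (x1u1, x1u2) (x2u1, x2u2) add0r -raddfD
      ?addr0 ?add0r.
  rewrite mulmxDl; case: sumN => ->; rewrite ?addr0; first by [].
  case=> [/eqP|/(canRL (addrK d))]; first by rewrite addff_eq0 => /eqP; right.
  by rewrite subrr; left.
pose N' := N + u1 *m (x1 *m N) + u2 *m (x2 *m N).
have [w defN'] : exists w : 'cV_p, N' = w *m d.
  exists (\col_i (row i N' != 0)%:R).
  apply/row_matrixP => i; rewrite row_mul.
  have -> : row i (\col_i0 (row i0 N' != 0)%:R) = ((row i N' != 0)%:R)%:M :> 'M['F_2]_1.
    by apply/matrixP=> j k; rewrite !mxE !ord1 eqxx.
  pose x : 'rV_p := delta_mx 0 i + u1 i 0 *: x1 + u2 i 0 *: x2.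
  have -> : row i N' = x *m N.
    rewrite !linearD /= !row_mul !mulmxDl -rowE -!scalemxAl.
    by congr (_ + _ + _); rewrite [row i _]mx11_scalar mul_scalar_mx mxE.
  have E u (t := u i 0) : row i u = t%:M :> 'M_1.
    by rewrite [row i u]mx11_scalar mxE.
  have [||->|->] := homN x.
  - rewrite !mulmxDl -rowE -!scalemxAl x1u1 x2u1 E raddf0 scaler0 addr0.
    by rewrite scale_scalar_mx mulr1 addff.
  - rewrite !mulmxDl -rowE -!scalemxAl x1u2 x2u2 E raddf0 scaler0 addr0.
    by rewrite scale_scalar_mx mulr1 addff.
  - by rewrite eqxx mul_scalar_mx scale0r.
  rewrite mul_scalar_mx; case: eqP => [->|_]; by rewrite ?scaler0 ?scale1r.
have {}defN' : N = u1 *m (x1 *m N) + u2 *m (x2 *m N) + w *m d.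
  by rewrite -defN' /N' -[N + _ + _]addrA [N + (_ + _)]addrC addrA addff add0r.
move: sumN; rewrite mulmxDl.
move: (x1 *m N) (x2 *m N) defN' => y1 y2 -> [/eqP|/(canRL (addKr _))].
  by rewrite addff_eq0 => /eqP <-; exists y1, w; rewrite (mulmxDl u1).
rewrite oppff => ->; exists y1, (w + u2).
rewrite (mulmxDl u1) (mulmxDl w) mulmxDr -!addrA; do 2!congr (_ + _).
exact: addrC.
Qed.

Lemma outer_eq0 (u : 'cV['F_2]_p) (v : 'rV['F_2]_n) : u *m v != 0 -> (u != 0) && (v != 0).
Proof.
by move=> uv; apply/andP; split; apply: contraNneq uv => ->; rewrite ?mul0mx ?mulmx0.
Qed.

Lemma normal_form_exists S :
    affine_of_codim 3 S -> S != set0 ->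
    (forall M, M \in S -> (2 <= \rank M)%N) ->
  exists v1 v2 a u1 u2 w, [/\ v1 != 0, v2 != 0, uniq [:: 0; u1; u2]
    & S = normal_form v1 v2 a u1 u2 w].
Proof.
move=> codimS S0 rkS.
have S'0 : 0 \notin S by apply/negP => /rkS; rewrite mxrank0.
have [s dS] := dual_quadruple_exists codimS S'0.
have dSperm s' : perm_eq s s' -> dual_quadruple S s'.
  case: dS => ss sum0 memS eqs; split=> [||M].
  - by rewrite -(perm_size eqs).
  - by rewrite -(perm_big _ eqs).
  by rewrite memS; apply: perm_all.
have [N1 sN1 /rank_le1[u1 [v1 defN1]]] := exists_rank1 S0 rkS dS.
have eqs1 := perm_to_rem sN1; rewrite defN1 in eqs1.
have [N2 [u2 [v2 [sN2 defN2 u12]]]] := exists_second_rank1 S0 rkS (dSperm _ eqs1).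
have eqs2 := perm_to_rem sN2; rewrite -(perm_cons (u1 *m v1)) defN2 in eqs2.
have {dSperm} := dSperm _ (perm_trans eqs1 eqs2).
move: (rem _ _) => {sN2 sN1 eqs1 eqs2 defN1 defN2 N1 N2}s' {}dS.
have [/= ss sum0 memS] := dS.
case: s' ss sum0 memS dS => [|N3 [|N4 [|]]] //= _ sum0 memS dS.
have {}memS M : (M \in S) =
   [&& pairing v1 M u1 == 1, pairing v2 M u2 == 1, \tr (N3 *m M) == 1 & \tr (N4 *m M) == 1].
  by rewrite memS /= !trace_pairing andbT.
have defN4 : N4 = N3 + u1 *m v1 + u2 *m v2.
  move: sum0; rewrite !big_cons big_nil addr0 !addrA => /eqP; rewrite addff_eq0 => /eqP <-.
  by rewrite addrC addrA.
have /andP[u1nz v1nz] : (u1 != 0) && (v1 != 0).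
  by apply/outer_eq0/(quadruple_neq0 S0 dS); rewrite !inE eqxx.
have /andP[u2nz v2nz] : (u2 != 0) && (v2 != 0).
  by apply/outer_eq0/(quadruple_neq0 S0 dS); rewrite !inE eqxx orbT.
have [|a [w defN3]] := @two_valued_factor N3 u1 u2 v1 v2 u1nz u2nz u12.
  move=> x xu1 xu2; have := row_annihilated dS rkS x.
  rewrite /= !mulmxA [x *m u1]mx11_scalar [x *m u2]mx11_scalar xu1 xu2 !mul1mx.
  rewrite (negbTE v1nz) (negbTE v2nz) orbF.
  rewrite defN4 !mulmxDr !mulmxA [x *m u1]mx11_scalar [x *m u2]mx11_scalar xu1 xu2 !mul1mx.
  by rewrite -addrA addff_eq0 /= => /orP[] /eqP ->; [left | right].
exists v1, v2, a, u1, u2, w; split=> //.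
  by rewrite /= !inE !negb_or u12 ![0 == _]eq_sym u1nz u2nz.
apply/setP => M; rewrite memS in_normal_form defN4 defN3.
rewrite mulmxDr !mulmxDl !linearD /= !trace_pairing !pairingE.
move: (_ + _ + (_ + _)) (pairing v1 M u1) (pairing v2 M u2) => x y z.
by case_F2 x; case_F2 y; case_F2 z.
Qed.
End NormalForm.

(** * Linear dependencies and equivalence *)

(** Linear independence over F_2, where the only scalars are 0 and 1. *)
Definition free2 (V : zmodType) (x y : V) := uniq [:: 0; x; y].

Definition free3 (V : zmodType) (x y z : V) :=
  free2 x y && (z \notin [:: 0; x; y; x + y]).

Lemma free2_tr k m (x y : 'M['F_2]_(k, m)) : free2 x^T y^T = free2 x y.
Proof. by rewrite /free2 -(trmx0 _ k m) -(map_inj_uniq (@trmx_inj _ k m) [:: 0; x; y]). Qed.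

Lemma free3_tr k m (x y z : 'M['F_2]_(k, m)) : free3 x^T y^T z^T = free3 x y z.
Proof.
rewrite /free3 free2_tr -(trmx0 _ k m) -raddfD.
by rewrite -(mem_map (@trmx_inj _ k m) [:: 0; x; y; x + y]).
Qed.

Section Free.
Variable m : nat.
Implicit Types v : 'rV['F_2]_m.

Lemma free2_row_free v1 v2 : free2 v1 v2 -> row_free (col_mx v1 v2).
Proof.
rewrite /free2 /= !inE !negb_or andbT => /andP[/andP[nz1 nz2] n12].
rewrite -kermx_eq0; apply/rowV0P => c /sub_kermxP.
rewrite -[c]hsubmxK mul_row_col [lsubmx c]mx11_scalar [rsubmx c]mx11_scalar.
rewrite !mul_scalar_mx; move: (lsubmx _ _ _) (rsubmx _ _ _) => c1 c2.
case_F2 c1; case_F2 c2; rewrite ?scale0r ?scale1r ?add0r ?addr0 => /eqP.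
- by rewrite raddf0 row_mx0.
- by rewrite eq_sym (negbTE nz2).
- by rewrite eq_sym (negbTE nz1).
by rewrite addff_eq0 (negbTE n12).
Qed.

Lemma free3_row_free v1 v2 v3 : free3 v1 v2 v3 -> row_free (col_mx (col_mx v1 v2) v3).
Proof.
case/andP=> /free2_row_free free12; rewrite !inE !negb_or => /and4P[nz n1 n2 n12].
rewrite -kermx_eq0; apply/rowV0P => c /sub_kermxP.
rewrite -[c]hsubmxK mul_row_col [rsubmx c]mx11_scalar mul_scalar_mx.
move: (lsubmx c) (rsubmx c 0 0) => b c3.
case_F2 c3; rewrite ?scale0r ?scale1r ?addr0 => /eqP.
  rewrite -[0 in X in X -> _](mul0mx _ (col_mx v1 v2)).
  by rewrite (inj_eq (row_free_inj free12)) raddf0 => /eqP->; rewrite row_mx0.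
rewrite addff_eq0 eq_sym -[b]hsubmxK mul_row_col.
rewrite [lsubmx b]mx11_scalar [rsubmx b]mx11_scalar !mul_scalar_mx.
move: (lsubmx _ _ _) (rsubmx _ _ _) => c1 c2.
by case_F2 c1; case_F2 c2; rewrite ?scale0r ?scale1r ?add0r ?addr0
  ?(negbTE nz, negbTE n1, negbTE n2, negbTE n12).
Qed.

Lemma free2_basis_change v1 v2 v1' v2' : free2 v1 v2 -> free2 v1' v2' ->
  exists2 g : 'M_m, g \in unitmx & v1 *m g = v1' /\ v2 *m g = v2'.
Proof.
move=> /free2_row_free fv /free2_row_free fv'.
have [g ug] := row_basis_change fv fv'.
by rewrite mul_col_mx => /eq_col_mx; exists g.
Qed.

Lemma free3_basis_change v1 v2 v3 v1' v2' v3' : free3 v1 v2 v3 -> free3 v1' v2' v3' ->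
  exists2 g : 'M_m, g \in unitmx & [/\ v1 *m g = v1', v2 *m g = v2' & v3 *m g = v3'].
Proof.
move=> /free3_row_free fv /free3_row_free fv'.
have [g ug] := row_basis_change fv fv'.
by rewrite !mul_col_mx => /eq_col_mx[/eq_col_mx[]]; exists g.
Qed.

Lemma free2_col_basis_change (u1 u2 u1' u2' : 'cV['F_2]_m) : free2 u1 u2 -> free2 u1' u2' ->
  exists2 h : 'M_m, h \in unitmx & h *m u1 = u1' /\ h *m u2 = u2'.
Proof.
rewrite -(free2_tr u1) -(free2_tr u1') => fu fu'.
have [g ug [e1 e2]] := free2_basis_change fu fu'.
exists g^T; first by rewrite unitmx_tr.
by split; apply: trmx_inj; rewrite trmx_mul trmxK.
Qed.

Lemma free3_col_basis_change (u1 u2 u3 u1' u2' u3' : 'cV['F_2]_m) :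
    free3 u1 u2 u3 -> free3 u1' u2' u3' ->
  exists2 h : 'M_m, h \in unitmx & [/\ h *m u1 = u1', h *m u2 = u2' & h *m u3 = u3'].
Proof.
rewrite -(free3_tr u1) -(free3_tr u1') => fu fu'.
have [g ug [e1 e2 e3]] := free3_basis_change fu fu'.
exists g^T; first by rewrite unitmx_tr.
by split; apply: trmx_inj; rewrite trmx_mul trmxK.
Qed.

Lemma free3_dim v1 v2 v3 : free3 v1 v2 v3 -> (3 <= m)%N.
Proof. by move/free3_row_free/eqP=> rk; rewrite -[3%N]/(1 + 1 + 1)%N -rk rank_leq_col. Qed.

End Free.

Section Equivalence.
Variables n p : nat.
Implicit Types (S : {set 'M['F_2]_(n, p)}).

Lemma equivalent_sym S S' : equivalent S S' -> equivalent S' S.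
Proof.
case=> P [Q [uP uQ ->]]; exists (invmx P), (invmx Q); split; rewrite ?unitmx_inv //.
rewrite -imset_comp -[LHS]imset_id; apply: eq_imset => M /=.
by rewrite invmxK !mulmxA mulVmx // mul1mx mulmxKV.
Qed.

Lemma equivalent_preim S S' (P : 'M_n) (Q : 'M_p) : P \in unitmx -> Q \in unitmx ->
  (forall M, (M \in S) = (P *m M *m Q \in S')) -> equivalent S S'.
Proof.
move=> uP uQ memS; exists P, (invmx Q); split; rewrite ?unitmx_inv //.
apply/setP => M; apply/idP/imsetP => [S'M | [M0 SM0 ->]]; last first.
  by rewrite invmxK -memS.
exists (invmx P *m M *m invmx Q); last by rewrite invmxK !mulmxA mulmxV // mul1mx mulmxKV.
by rewrite memS !mulmxA mulmxV // mul1mx mulmxKV.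
Qed.

Lemma normal_form_equivalent (P : 'M_n) (Q : 'M_p) v1 v2 a u1 u2 w :
    P \in unitmx -> Q \in unitmx ->
  equivalent (normal_form (v1 *m P) (v2 *m P) (a *m P) (Q *m u1) (Q *m u2) (Q *m w))
             (normal_form v1 v2 a u1 u2 w).
Proof.
move=> uP uQ; apply: (equivalent_preim uP uQ) => M.
by rewrite 2!in_normal_form -!mulmxDl -mulmxDr /pairing !mulmxA.
Qed.

End Equivalence.

(** * The five kinds of normal forms *)

Section Kinds.
Variables n p : nat.
Implicit Types (S : {set 'M['F_2]_(n, p)}) (v a : 'rV['F_2]_n) (u w : 'cV['F_2]_p).

Inductive normal_form_kind S : Prop :=
| KindC v1 v2 u1 u2 of free2 v1 v2 & free2 u1 u2
    & S = normal_form v1 v2 (v1 + v2) u1 u2 0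
| KindJ v1 v2 u1 u2 of free2 v1 v2 & free2 u1 u2
    & S = normal_form v1 v2 v2 u1 u2 0
| KindF2 v1 v2 u1 u2 w of free2 v1 v2 & free3 u1 u2 w
    & S = normal_form v1 v2 0 u1 u2 w
| KindF2T v1 v2 a u1 u2 of free3 v1 v2 a & free2 u1 u2
    & S = normal_form v1 v2 a u1 u2 0
| KindF3 v1 v2 a u1 u2 w of free3 v1 v2 a & free3 u1 u2 w
    & S = normal_form v1 v2 a u1 u2 w.

Lemma free2C (V : zmodType) (x y : V) : free2 x y = free2 y x.
Proof.
rewrite /free2 /= !inE !negb_or !andbT (eq_sym x y).
by case: (0 == x); case: (0 == y).
Qed.

(** The list enumerates the span of u1 and u2. *)
Lemma span4_addl (V : lmodType 'F_2) (u1 u2 w : V) :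
  (w + u1 \in [:: 0; u1; u2; u1 + u2]) = (w \in [:: 0; u1; u2; u1 + u2]).
Proof.
have shift y : (w + u1 == y) = (w == y + u1) by rewrite -subr_eq oppff.
rewrite !inE !shift add0r addff (addrC u2) addrAC addff add0r.
by case: (w == u1); case: (w == 0); case: (w == u2); case: (w == u1 + u2).
Qed.

Lemma span4_addr (V : lmodType 'F_2) (u1 u2 w : V) :
  (w + u2 \in [:: 0; u1; u2; u1 + u2]) = (w \in [:: 0; u1; u2; u1 + u2]).
Proof.
have shift y : (w + u2 == y) = (w == y + u2) by rewrite -subr_eq oppff.
rewrite !inE !shift add0r addff -addrA addff addr0.
by case: (w == u1); case: (w == 0); case: (w == u2); case: (w == u1 + u2).
Qed.

(** If v1 = v2, the space is that of the three pairs (v1, u1), (v1, u2) and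
    (a, u1 + u2), of the kind of J.  Otherwise shifts bring w to 0 when it
    lies in the span of u1, u2, and else a to 0 when it lies in the span of v1, v2.
    If w = 0 and a is in the span of v1, v2, then a is 0 (an empty space), v1 or v2
    (kind J) or v1 + v2 (kind C). *)
Lemma normal_form_kindP v1 v2 a u1 u2 w : v1 != 0 -> v2 != 0 -> free2 u1 u2 ->
  normal_form v1 v2 a u1 u2 w != set0 -> normal_form_kind (normal_form v1 v2 a u1 u2 w).
Proof.
move=> v1nz v2nz fu.
have shift1 b y : normal_form v1 v2 (b + v1) u1 u2 (y + u2) = normal_form v1 v2 b u1 u2 y.
  by rewrite -normal_form_swap normal_form_shift normal_form_swap.
have [<-|v12] := eqVneq v1 v2.
  have -> : normal_form v1 v1 a u1 u2 w = normal_form a v1 v1 (u1 + u2) u1 0.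
    apply/setP=> M; rewrite 2!in_normal_form !pairingE.
    move: (_ + _) (pairing v1 M u1) (pairing v1 M u2) (pairing v1 M w) => x y z t.
    by case_F2 x; case_F2 y; case_F2 z; case_F2 t.
  move=> nf0; apply: (@KindJ _ a v1 (u1 + u2) u1) => //; last first.
    move: fu; rewrite /free2 /= !inE !negb_or ![0 == _]eq_sym => /andP[/andP[nz1 nz2]].
    rewrite addff_eq0 !andbT => n12.
    by rewrite n12 nz1 eq_sym addrC -subr_eq subrr eq_sym nz2.
  have /set0Pn[M] := nf0; rewrite in_normal_form !pairingE.
  rewrite /free2 /= !inE !negb_or ![0 == _]eq_sym v1nz !andbT /= => nfM.
  apply/andP; split; apply: contraTneq nfM => ->; rewrite ?pairingE //.
  by move: (pairing v1 M u1) (pairing v1 M u2) => x y; case_F2 x; case_F2 y.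
have fv : free2 v1 v2 by rewrite /free2 /= !inE !negb_or v12 ![0 == _]eq_sym v1nz v2nz.
case: (boolP (w \in [:: 0; u1; u2; u1 + u2])) => [wu|wu]; last first.
  case: (boolP (a \in [:: 0; v1; v2; v1 + v2])) => [av _|av _]; last first.
    by apply: (@KindF3 _ v1 v2 a u1 u2 w); rewrite /free3 ?fv ?fu.
  have /(_ av)[y nfE yu] : a \in [:: 0; v1; v2; v1 + v2] -> exists2 y,
      normal_form v1 v2 a u1 u2 w = normal_form v1 v2 0 u1 u2 y
      & y \notin [:: 0; u1; u2; u1 + u2].
    rewrite !inE => /or4P[] /eqP->.
    - by exists w.
    - by exists (w + u2); rewrite ?span4_addr // -shift1 addff.
    - by exists (w + u1); rewrite ?span4_addl // -normal_form_shift addff.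
    exists (w + u2 + u1); last by rewrite span4_addl span4_addr.
    by rewrite -shift1 -normal_form_shift -addrA addff.
  by rewrite nfE; apply: (@KindF2 _ v1 v2 u1 u2 y); rewrite /free3 ?fv ?fu.
have [b ->] : exists b, normal_form v1 v2 a u1 u2 w = normal_form v1 v2 b u1 u2 0.
  move: wu; rewrite !inE => /or4P[] /eqP->.
  - by exists a.
  - by exists (a + v2); rewrite -normal_form_shift addff.
  - by exists (a + v1); rewrite -shift1 addff.
  by exists (a + v1 + v2); rewrite -shift1 -normal_form_shift -[u1 + u2 + u2]addrA addff
    addr0 addff.
case: (boolP (b \in [:: 0; v1; v2; v1 + v2])) => [|bv _]; last first.
  by apply: (@KindF2T _ v1 v2 b u1 u2); rewrite /free3 ?fv ?fu.
rewrite !inE => /or4P[] /eqP->.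
- case/set0Pn=> M; by rewrite in_normal_form !pairingE add0r !andbF.
- rewrite -normal_form_swap => _; apply: (@KindJ _ v2 v1 u2 u1); rewrite // free2C //.
- by move=> _; apply: (@KindJ _ v1 v2 u1 u2).
by move=> _; apply: (@KindC _ v1 v2 u1 u2).
Qed.

End Kinds.

(** * The five model spaces *)

Definition std_row m (i : nat) : 'rV['F_2]_m := \row_j (j == i :> nat)%:R.

Local Notation e := std_row.

Lemma std_rowE m i (lt_im : (i < m)%N) : e m i = delta_mx 0 (Ordinal lt_im).
Proof. by apply/rowP=> j; rewrite !mxE eqxx. Qed.

Ltac coordinates lt0 lt1 lt2 :=
  rewrite /free3 /free2 /= ?inE ?negb_or ?andbT;
  repeat (apply/andP; split); apply/eqP => /rowP;
  let E := fresh "E" in move=> E;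
  first [ by move: (E (Ordinal lt0)); rewrite !mxE => /eqP
        | by move: (E (Ordinal lt1)); rewrite !mxE => /eqP
        | by move: (E (Ordinal lt2)); rewrite !mxE => /eqP].

Lemma free_std_row2 m : (2 <= m)%N ->
  [/\ free2 (e m 0) (e m 1) & free2 (e m 0) (e m 0 + e m 1)].
Proof.
move=> lt1; have lt0 := ltnW lt1.
split; coordinates lt0 lt1 lt1.
Qed.

Lemma free_std_row3 m : (3 <= m)%N ->
  [/\ free3 (e m 0 + e m 1) (e m 1 + e m 2) (e m 1),
      free3 (e m 1) (e m 1 + e m 2) (e m 0 + e m 1)
    & free3 (e m 0 + e m 1) (e m 1) (e m 2)].
Proof.
move=> lt2; have lt1 := ltnW lt2; have lt0 := ltnW lt1.
split; coordinates lt0 lt1 lt2.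
Qed.

(** The five models are the spaces of the theorem described by their equations.
    They are locked, for otherwise the comparison of two different models unfolds
    them down to matrix entries. *)
HB.lock Definition model_C n p : {set 'M['F_2]_(n, p)} :=
  normal_form (e n 0) (e n 1) (e n 0 + e n 1) (e p 0)^T (e p 0 + e p 1)^T 0.

Lemma model_CE n p : model_C n p =
  normal_form (e n 0) (e n 1) (e n 0 + e n 1) (e p 0)^T (e p 0 + e p 1)^T 0.
Proof. by rewrite model_C.unlock. Qed.

HB.lock Definition model_J n p : {set 'M['F_2]_(n, p)} :=
  normal_form (e n 0) (e n 1) (e n 1) (e p 0)^T (e p 1)^T 0.

Lemma model_JE n p : model_J n p =
  normal_form (e n 0) (e n 1) (e n 1) (e p 0)^T (e p 1)^T 0.
Proof. by rewrite model_J.unlock. Qed.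

HB.lock Definition model_F2 n p : {set 'M['F_2]_(n, p)} :=
  normal_form (e n 0) (e n 1) 0 (e p 0 + e p 1)^T (e p 1 + e p 2)^T (e p 1)^T.

Lemma model_F2E n p : model_F2 n p =
  normal_form (e n 0) (e n 1) 0 (e p 0 + e p 1)^T (e p 1 + e p 2)^T (e p 1)^T.
Proof. by rewrite model_F2.unlock. Qed.

HB.lock Definition model_F2T n p : {set 'M['F_2]_(n, p)} :=
  normal_form (e n 0 + e n 1) (e n 1 + e n 2) (e n 1) (e p 0)^T (e p 1)^T 0.

Lemma model_F2TE n p : model_F2T n p =
  normal_form (e n 0 + e n 1) (e n 1 + e n 2) (e n 1) (e p 0)^T (e p 1)^T 0.
Proof. by rewrite model_F2T.unlock. Qed.

HB.lock Definition model_F3 n p : {set 'M['F_2]_(n, p)} :=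
  normal_form (e n 1) (e n 1 + e n 2) (e n 0 + e n 1)
    (e p 0 + e p 1)^T (e p 1)^T (e p 2)^T.

Lemma model_F3E n p : model_F3 n p =
  normal_form (e n 1) (e n 1 + e n 2) (e n 0 + e n 1)
    (e p 0 + e p 1)^T (e p 1)^T (e p 2)^T.
Proof. by rewrite model_F3.unlock. Qed.

Section Models.
Variables n p : nat.

(** The independent vectors of each kind are moved to those of the model by base
    changes on both sides; two free families of the same size are always related
    in this way. *)
Lemma normal_form_kind_model (n2 : (2 <= n)%N) (p2 : (2 <= p)%N) S :
    normal_form_kind S ->
  [\/ equivalent S (model_C n p), equivalent S (model_J n p),
      (3 <= p)%N /\ equivalent S (model_F2 n p)
    | (3 <= n)%N /\ (equivalent S (model_F2T n p) \/
                       (3 <= p)%N /\ equivalent S (model_F3 n p))].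
Proof.
case=> [v1 v2 u1 u2 fv fu ->|v1 v2 u1 u2 fv fu ->|v1 v2 u1 u2 w fv fu ->|
      v1 v2 a u1 u2 fv fu ->|v1 v2 a u1 u2 w fv fu ->].
- have [free01 free001] := free_std_row2 n2; have [_ free001p] := free_std_row2 p2.
  have [P uP [<- <-]] := free2_basis_change free01 fv.
  have [Q uQ [<- <-]] := free2_col_basis_change (etrans (free2_tr _ _) free001p) fu.
  constructor 1; rewrite model_CE.
  have := normal_form_equivalent (e n 0) (e n 1) (e n 0 + e n 1)
    (e p 0)^T (e p 0 + e p 1)^T 0 uP uQ.
  by rewrite mulmx0 mulmxDl.
- have [free01 _] := free_std_row2 n2; have [free01p _] := free_std_row2 p2.
  have [P uP [<- <-]] := free2_basis_change free01 fv.
  have [Q uQ [<- <-]] := free2_col_basis_change (etrans (free2_tr _ _) free01p) fu.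
  constructor 2; rewrite model_JE.
  have := normal_form_equivalent (e n 0) (e n 1) (e n 1)
    (e p 0)^T (e p 1)^T 0 uP uQ.
  by rewrite mulmx0.
- have [free01 _] := free_std_row2 n2.
  have p3 : (3 <= p)%N by apply: (@free3_dim _ u1^T u2^T w^T); rewrite free3_tr.
  have [freep _ _] := free_std_row3 p3.
  have [P uP [<- <-]] := free2_basis_change free01 fv.
  have [Q uQ [<- <- <-]] := free3_col_basis_change (etrans (free3_tr _ _ _) freep) fu.
  constructor 3; split=> //; rewrite model_F2E.
  have := normal_form_equivalent (e n 0) (e n 1) 0
    (e p 0 + e p 1)^T (e p 1 + e p 2)^T (e p 1)^T uP uQ.
  by rewrite mul0mx.
- have n3 := free3_dim fv; have [freen _ _] := free_std_row3 n3.
  have [free01 _] := free_std_row2 p2.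
  have [P uP [<- <- <-]] := free3_basis_change freen fv.
  have [Q uQ [<- <-]] := free2_col_basis_change (etrans (free2_tr _ _) free01) fu.
  constructor 4; split=> //; left; rewrite model_F2TE.
  have := normal_form_equivalent (e n 0 + e n 1) (e n 1 + e n 2) (e n 1)
    (e p 0)^T (e p 1)^T 0 uP uQ.
  by rewrite mulmx0.
have n3 := free3_dim fv; have [_ freen _] := free_std_row3 n3.
have p3 : (3 <= p)%N by apply: (@free3_dim _ u1^T u2^T w^T); rewrite free3_tr.
have [_ _ freep] := free_std_row3 p3.
have [P uP [<- <- <-]] := free3_basis_change freen fv.
have [Q uQ [<- <- <-]] := free3_col_basis_change (etrans (free3_tr _ _ _) freep) fu.
constructor 4; split=> //; right; split=> //; rewrite model_F3E.
exact: normal_form_equivalent.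
Qed.

Definition entry (M : 'M['F_2]_(n, p)) i j := pairing (e n i) M (e p j)^T.

Lemma entryE M i j (lt_in : (i < n)%N) (lt_jp : (j < p)%N) :
  entry M i j = M (Ordinal lt_in) (Ordinal lt_jp).
Proof. by rewrite /entry /pairing !std_rowE trmx_delta -rowE -colE !mxE. Qed.

Lemma corner_rows n' p' (hn : (n' <= n)%N) (hp : (p' <= p)%N) M s :
  (mxsub (widen_ord hn) (widen_ord hp) M == mx_of_rows n' p' s)
  = all (fun i => all (fun j => entry M i j == nth 0 (nth [::] s i) j) (iota 0 p')) (iota 0 n').
Proof.
apply/eqP/allP => [/matrixP eqM i | eqM].
  rewrite mem_iota => lt_in'; apply/allP => j; rewrite mem_iota => lt_jp'.
  have := eqM (Ordinal lt_in') (Ordinal lt_jp'); rewrite !mxE /= => <-.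
  have lt_in := leq_trans lt_in' hn; have lt_jp := leq_trans lt_jp' hp.
  rewrite (entryE M lt_in lt_jp); apply/eqP; congr (M _ _); exact: val_inj.
apply/matrixP => i j; rewrite !mxE.
have /eqM/allP/(_ (val j)) : val i \in iota 0 n' by rewrite mem_iota ltn_ord.
rewrite mem_iota ltn_ord => /(_ isT)/eqP <-.
rewrite (entryE M (leq_trans (ltn_ord i) hn) (leq_trans (ltn_ord j) hp)).
by congr (M _ _); exact: val_inj.
Qed.


Lemma pairing_entry M i j : pairing (e n i) M (e p j)^T = entry M i j.
Proof. by []. Qed.

Ltac case_entries :=
  match goal with
  | |- context [entry ?M ?i ?j] =>
      generalize (entry M i j); case_entries;
      let x := fresh "x" in move=> x; case: (F2P x) => {x}->
  | _ => idtac
  end.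

Ltac in_model := rewrite in_normal_form ?raddfD !pairingE /= ?addr0 ?add0r !pairing_entry;
  by case_entries.

Lemma in_model_C M : (M \in model_C n p) =
  [&& entry M 0 0 == 1, entry M 1 0 + entry M 1 1 == 1 & entry M 0 1 + entry M 1 1 == 1].
Proof. by rewrite model_CE; in_model. Qed.

Lemma in_model_J M : (M \in model_J n p) =
  [&& entry M 0 0 == 1, entry M 1 1 == 1 & entry M 1 0 + entry M 1 1 == 1].
Proof. by rewrite model_JE; in_model. Qed.

Lemma in_model_F2 M : (M \in model_F2 n p) =
  [&& entry M 0 0 + entry M 0 1 == 1, entry M 1 1 + entry M 1 2 == 1
    & entry M 0 1 + entry M 1 1 == 1].
Proof. by rewrite model_F2E; in_model. Qed.

Lemma in_model_F2T M : (M \in model_F2T n p) =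
  [&& entry M 0 0 + entry M 1 0 == 1, entry M 1 1 + entry M 2 1 == 1
    & entry M 1 0 + entry M 1 1 == 1].
Proof. by rewrite model_F2TE; in_model. Qed.

Lemma in_model_F3 M : (M \in model_F3 n p) =
  [&& entry M 1 0 + entry M 1 1 == 1, entry M 1 1 + entry M 2 1 == 1
    & entry M 0 0 + entry M 1 0 + entry M 2 2 == 1].
Proof. by rewrite model_F3E; in_model. Qed.

Lemma in_id_line (N : 'M['F_2]_2) B : (B \in id_line N) = [exists a : 'F_2, B == 1%:M + a *: N].
Proof. by apply/imsetP/existsP => [[a _ ->]|[a /eqP->]]; exists a. Qed.

Lemma id_line_C (a : 'F_2) : 1%:M + a *: Cmx = mx_of_rows 2 2 [:: [:: 1; a]; [:: a; 1 + a]].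
Proof.
by apply/matrixP => -[[|[|//]] lti] [[|[|//]] ltj]; rewrite !mxE /= ?mulr0 ?mulr1 ?addr0 ?add0r.
Qed.

Lemma id_line_J (a : 'F_2) : 1%:M + a *: Jmx = mx_of_rows 2 2 [:: [:: 1; a]; [:: 0; 1]].
Proof.
by apply/matrixP => -[[|[|//]] lti] [[|[|//]] ltj]; rewrite !mxE /= ?mulr0 ?mulr1 ?addr0 ?add0r.
Qed.

Lemma corner_C (n2 : (2 <= n)%N) (p2 : (2 <= p)%N) :
  corner_ext n2 p2 (id_line Cmx) = model_C n p.
Proof.
apply/setP=> M; rewrite inE in_id_line in_model_C.
apply/existsP/idP => [[a]|memM].
  by rewrite id_line_C corner_rows /= !andbT; case_F2 a; case_entries.
by exists (entry M 0 1); rewrite id_line_C corner_rows; move: memM => /=; case_entries.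
Qed.

Lemma corner_J (n2 : (2 <= n)%N) (p2 : (2 <= p)%N) :
  corner_ext n2 p2 (id_line Jmx) = model_J n p.
Proof.
apply/setP=> M; rewrite inE in_id_line in_model_J.
apply/existsP/idP => [[a]|memM].
  by rewrite id_line_J corner_rows /= !andbT; case_F2 a; case_entries.
by exists (entry M 0 1); rewrite id_line_J corner_rows; move: memM => /=; case_entries.
Qed.

Lemma corner_F2 (n2 : (2 <= n)%N) (p3 : (3 <= p)%N) :
  corner_ext n2 p3 calF2 = model_F2 n p.
Proof.
apply/setP=> M; rewrite inE [_ \in calF2]inE in_model_F2; apply/idP/idP => [|memM].
  case/existsP=> a /existsP[c /existsP[d]].
  rewrite corner_rows /= !andbT => /andP[/and3P[/eqP-> /eqP-> _] /and3P[_ /eqP-> /eqP->]].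
  by case_F2 a.
apply/existsP; exists (entry M 0 1); apply/existsP; exists (entry M 0 2).
apply/existsP; exists (entry M 1 0); rewrite corner_rows; move: memM => /=.
by case_entries.
Qed.

Lemma in_trset k m (X : {set 'M['F_2]_(k, m)}) B : (B \in trset X) = (B^T \in X).
Proof. by rewrite -{1}[B]trmxK mem_imset //; apply: trmx_inj. Qed.

Lemma corner_F2T (n3 : (3 <= n)%N) (p2 : (2 <= p)%N) :
  corner_ext n3 p2 (trset calF2) = model_F2T n p.
Proof.
have tr_rows (a c d : 'F_2) : mx_of_rows 2 3 [:: [:: a + 1; a; c]; [:: d; a + 1; a]]
    = (mx_of_rows 3 2 [:: [:: a + 1; d]; [:: a; a + 1]; [:: c; a]])^T.
  by apply/matrixP => -[[|[|//]] lti] [[|[|[|//]]] ltj]; rewrite !mxE.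
apply/setP=> M; rewrite inE in_trset inE in_model_F2T; apply/idP/idP => [|memM].
  case/existsP=> a /existsP[c /existsP[d]].
  rewrite tr_rows (inj_eq trmx_inj) corner_rows /= !andbT.
  case/and3P=> /andP[/eqP-> _] /andP[/eqP-> /eqP->] /andP[_ /eqP->].
  by case_F2 a.
apply/existsP; exists (entry M 1 0); apply/existsP; exists (entry M 2 0).
apply/existsP; exists (entry M 0 1); rewrite tr_rows (inj_eq trmx_inj) corner_rows.
by move: memM => /=; case_entries.
Qed.

Lemma corner_F3 (n3 : (3 <= n)%N) (p3 : (3 <= p)%N) :
  corner_ext n3 p3 calF3 = model_F3 n p.
Proof.
apply/setP=> M; rewrite inE [_ \in calF3]inE in_model_F3; apply/idP/idP => [|memM].
  case/existsP=> a /existsP[b /existsP[c /existsP[d /existsP[x /existsP[f]]]]].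
  rewrite corner_rows /= !andbT.
  case/and3P=> /and3P[/eqP-> _ _] /and3P[/eqP-> /eqP-> _] /and3P[_ /eqP-> /eqP->].
  by case_F2 a; case_F2 b.
apply/existsP; exists (entry M 0 0); apply/existsP; exists (entry M 2 2).
apply/existsP; exists (entry M 2 0); apply/existsP; exists (entry M 0 1).
apply/existsP; exists (entry M 0 2); apply/existsP; exists (entry M 1 2).
rewrite corner_rows /= !eqxx !andbT /=.
by move: memM; case_entries.
Qed.

End Models.

(** * The models have codimension 3 and lower rank 2 *)

Section Coordinates.
Variables n p : nat.

Definition lcoord (y : 'cV['F_2]_n) i := (std_row n i *m y) 0 0.
Definition rcoord (x : 'rV['F_2]_p) j := (x *m (std_row p j)^T) 0 0.

Lemma entry_outer y x i j : entry (y *m x) i j = lcoord y i * rcoord x j.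
Proof.
rewrite /entry /pairing mulmxA -mulmxA [_ *m y]mx11_scalar mul_scalar_mx mxE.
by [].
Qed.

Lemma lcoord_std i k : (i < n)%N -> lcoord (std_row n k)^T i = (i == k)%:R.
Proof. by move=> lt_in; rewrite /lcoord (std_rowE lt_in) -rowE !mxE. Qed.

Lemma rcoord_std j k : (j < p)%N -> rcoord (std_row p k) j = (j == k)%:R.
Proof. by move=> lt_jp; rewrite /rcoord (std_rowE lt_jp) trmx_delta -colE !mxE. Qed.

End Coordinates.

Ltac case_coords :=
  match goal with
  | |- context [lcoord ?y ?i] =>
      generalize (lcoord y i); case_coords;
      let t := fresh "t" in move=> t; case: (F2P t) => {t}->
  | |- context [rcoord ?x ?i] =>
      generalize (rcoord x i); case_coords;
      let t := fresh "t" in move=> t; case: (F2P t) => {t}->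
  | _ => idtac
  end.

Section Membership.
Variables n p : nat.

(** The three equations are independent as soon as they take all triples of
    values. *)
Lemma normal_form_codim3 v1 v2 a u1 u2 w :
    (forall t1 t2 t3, exists M : 'M['F_2]_(n, p), [/\ pairing v1 M u1 = t1, pairing v2 M u2 = t2
       & pairing a M (u1 + u2) + pairing (v1 + v2) M w = t3]) ->
  affine_of_codim 3 (@normal_form n p v1 v2 a u1 u2 w).
Proof.
move=> surj.
pose f (M : 'M['F_2]_(n, p)) : 'rV['F_2]_3 :=
  \row_i [:: pairing v1 M u1; pairing v2 M u2;
    pairing a M (u1 + u2) + pairing (v1 + v2) M w]`_i.
have linP v u c M M' : @pairing n p v (c *: M + M') u = c * pairing v M u + pairing v M' u.
  by rewrite /pairing mulmxDr mulmxDl -scalemxAr -scalemxAl !mxE.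
have lin : linear f.
  move=> c M M'; apply/rowP => i; rewrite !mxE.
  case: i => -[|[|[|//]]] lti; rewrite /= !linP //.
  by rewrite mulrDr addrACA.
pose L := GRing.isLinear.Build _ _ _ _ _ lin.
pose g : {linear _ -> _} := HB.pack f L.
have memf M t1 t2 t3 : (f M == \row_i [:: t1; t2; t3]`_i) = [&& pairing v1 M u1 == t1,
    pairing v2 M u2 == t2 & pairing a M (u1 + u2) + pairing (v1 + v2) M w == t3].
  apply/eqP/and3P => [/rowP fM | [/eqP e1 /eqP e2 /eqP e3]].
    split; apply/eqP.
    - by move: (fM (@Ordinal 3 0 isT)); rewrite !mxE.
    - by move: (fM (@Ordinal 3 1 isT)); rewrite !mxE.
    by move: (fM (@Ordinal 3 2 isT)); rewrite !mxE.
  by apply/rowP => i; rewrite !mxE e1 e2 e3.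
have surjf r : exists M, f M = r.
  have [M [e1 e2 e3]] := surj (r 0 (@Ordinal 3 0 isT))
    (r 0 (@Ordinal 3 1 isT)) (r 0 (@Ordinal 3 2 isT)).
  exists M; apply/rowP => i; rewrite mxE e1 e2 e3.
  by case: i => -[|[|[|//]]] lti; congr (r 0 _); apply: val_inj.
have [A fA] := surjf (\row_i [:: 1; 1; 1]`_i).
exists A, (lker (linfun g)); split.
  apply/setP=> M; rewrite in_normal_form -memf -fA.
  apply/eqP/imsetP => [fM | [M0]].
    exists (M - A); last by rewrite addrC subrK.
    by rewrite memv_ker lfunE linearB /= fM subrr.
  rewrite memv_ker lfunE => /eqP M0k ->.
  by have := linearD g A M0; rewrite /= => ->; rewrite [f M0]M0k addr0.
rewrite /codim -(limg_ker_dim (linfun g) fullv) capfv addnC addnK.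
have -> : limg (linfun g) = fullv.
  apply/vspaceP => r; rewrite memvf; have [M <-] := surjf r.
  by rewrite -[f M]/(g M) -(lfunE g) memv_img ?memvf.
by rewrite dimvf /dim /= mul1n.
Qed.

Lemma entryD (M M' : 'M_(n, p)) i j : entry (M + M') i j = entry M i j + entry M' i j.
Proof. by rewrite /entry /pairing mulmxDr mulmxDl mxE. Qed.

Lemma entry_rows s i j : (i < n)%N -> (j < p)%N ->
  entry (mx_of_rows n p s) i j = nth 0 (nth [::] s i) j.
Proof. by move=> lt_in lt_jp; rewrite (entryE _ lt_in lt_jp) mxE. Qed.

Definition two_units i j k l : 'M['F_2]_(n, p) :=
  (std_row n i)^T *m std_row p j + (std_row n k)^T *m std_row p l.

(** A sum of two matrix units has rank at most 2, so it realizes the minimum. *)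
Lemma lower_rank2 (S : {set 'M['F_2]_(n, p)}) i j k l :
    (forall (y : 'cV_n) (x : 'rV_p), y *m x \notin S) -> two_units i j k l \in S ->
  has_lower_rank 2 S.
Proof.
move=> no1 S2.
have rk2 M : M \in S -> (2 <= \rank M)%N.
  move=> SM; rewrite ltnNge; apply/negP => /rank_le1[y [x defM]].
  by have := no1 y x; rewrite -defM SM.
split=> //; exists (two_units i j k l) => //.
apply/eqP; rewrite eqn_leq rk2 // andbT.
apply: leq_trans (mxrank_add _ _) _; apply: (@leq_add _ _ 1 1);
  exact: leq_trans (mxrankM_maxr _ _) (rank_leq_row _).
Qed.

Ltac model_codim s := apply: normal_form_codim3;
  let t1 := fresh "t" in let t2 := fresh "t" in let t3 := fresh "t" in
  move=> t1 t2 t3; exists (mx_of_rows n p (s t1 t2 t3));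
  rewrite ?raddfD !pairingE /= ?addr0 ?add0r !pairing_entry !entry_rows //=;
  by case_F2 t1; case_F2 t2; case_F2 t3; split; apply/eqP.

Ltac model_rank mem i j k l := apply: (@lower_rank2 _ i j k l);
  [ let y := fresh "y" in let x := fresh "x" in move=> y x;
    rewrite mem !entry_outer; by case_coords
  | rewrite mem /two_units !entryD !entry_outer !lcoord_std // !rcoord_std //].

Lemma model_C_codim3_rank2 : (2 <= n)%N -> (2 <= p)%N -> codim3_lower_rank2 (model_C n p).
Proof.
move=> n2 p2; have [n1 p1] := (ltnW n2, ltnW p2).
split; last by model_rank in_model_C 0%N 0%N 1%N 1%N.
by rewrite model_CE; model_codim (fun t1 t2 t3 : 'F_2 => [:: [:: t1; t3]; [:: t2; 0]]).
Qed.

Lemma model_J_codim3_rank2 : (2 <= n)%N -> (2 <= p)%N -> codim3_lower_rank2 (model_J n p).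
Proof.
move=> n2 p2; have [n1 p1] := (ltnW n2, ltnW p2).
split; last by model_rank in_model_J 0%N 0%N 1%N 1%N.
by rewrite model_JE; model_codim (fun t1 t2 t3 : 'F_2 => [:: [:: t1; 0]; [:: t2 + t3; t2]]).
Qed.

Lemma model_F2_codim3_rank2 : (2 <= n)%N -> (3 <= p)%N -> codim3_lower_rank2 (model_F2 n p).
Proof.
move=> n2 p3; have p2 := ltnW p3; have [n1 p1] := (ltnW n2, ltnW p2).
split; last by model_rank in_model_F2 0%N 0%N 1%N 1%N.
by rewrite model_F2E; model_codim
  (fun t1 t2 t3 : 'F_2 => [:: [:: t1; 0; 0]; [:: 0; t3; t2 + t3]]).
Qed.

Lemma model_F2T_codim3_rank2 : (3 <= n)%N -> (2 <= p)%N -> codim3_lower_rank2 (model_F2T n p).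
Proof.
move=> n3 p2; have n2 := ltnW n3; have [n1 p1] := (ltnW n2, ltnW p2).
split; last by model_rank in_model_F2T 0%N 0%N 1%N 1%N.
by rewrite model_F2TE; model_codim
  (fun t1 t2 t3 : 'F_2 => [:: [:: t1; 0]; [:: 0; t3]; [:: 0; t2 + t3]]).
Qed.

Lemma model_F3_codim3_rank2 : (3 <= n)%N -> (3 <= p)%N -> codim3_lower_rank2 (model_F3 n p).
Proof.
move=> n3 p3; have [n2 p2] := (ltnW n3, ltnW p3); have [n1 p1] := (ltnW n2, ltnW p2).
split; last by model_rank in_model_F3 1%N 0%N 2%N 1%N.
by rewrite model_F3E; model_codim
  (fun t1 t2 t3 : 'F_2 => [:: [:: t1 + t3; 0; 0]; [:: t1; 0; 0]; [:: 0; t2; 0]]).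
Qed.

End Membership.

(** * Invariants of equivalence *)

Section Translations.
Variables n p : nat.
Implicit Types S : {set 'M['F_2]_(n, p)}.

Definition translations S : {set 'cV['F_2]_n * 'rV['F_2]_p} :=
  [set yx | [forall M in S, M + yx.1 *m yx.2 \in S]].

Definition left_translations S : {set 'cV['F_2]_n} :=
  [set y | [forall x, (y, x) \in translations S]].

Definition right_translations S : {set 'rV['F_2]_p} :=
  [set x | [forall y, (y, x) \in translations S]].

Definition translation_type S :=
  (#|left_translations S|, #|right_translations S|, #|translations S|).

Lemma translations_equivalent S S' (P : 'M_n) (Q : 'M_p) y x :
    P \in unitmx -> Q \in unitmx -> S' = [set P *m M *m invmx Q | M in S] ->
  (y, x) \in translations S -> (P *m y, x *m invmx Q) \in translations S'.
Proof.
move=> uP uQ ->; rewrite !inE /= => /forall_inP Syx.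
apply/forall_inP => _ /imsetP[M SM ->]; apply/imsetP.
by exists (M + y *m x); [exact: Syx | rewrite mulmxDr mulmxDl !mulmxA].
Qed.

Lemma equivalent_translation_le S S' : equivalent S S' ->
  [/\ #|left_translations S| <= #|left_translations S'|,
      #|right_translations S| <= #|right_translations S'|
    & #|translations S| <= #|translations S'|]%N.
Proof.
case=> P [Q [uP uQ defS']].
have injP : injective (mulmx P : 'cV_n -> 'cV_n) by apply: can_inj (mulKmx uP).
have injQ : injective (fun x : 'rV_p => x *m invmx Q).
  by apply: can_inj (mulmxKV uQ).
have trS' y x := @translations_equivalent S S' P Q y x uP uQ defS'.
split.
- rewrite -(card_imset _ injP); apply/subset_leq_card/subsetP => _ /imsetP[y Sy ->].
  rewrite inE; apply/forallP => x; rewrite -[x](mulmxK uQ); apply: trS'.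
  by move: Sy; rewrite inE => /forallP.
- rewrite -(card_imset _ injQ); apply/subset_leq_card/subsetP => _ /imsetP[x Sx ->].
  rewrite inE; apply/forallP => y; rewrite -[y](mulKVmx uP); apply: trS'.
  by move: Sx; rewrite inE => /forallP.
have injPQ : injective (fun yx : 'cV_n * 'rV_p => (P *m yx.1, yx.2 *m invmx Q)).
  by move=> [y x] [y' x'] /= [/injP-> /injQ->].
rewrite -(card_imset _ injPQ); apply/subset_leq_card/subsetP => _ /imsetP[[y x] Syx ->].
exact: trS'.
Qed.

Lemma equivalent_translation_type S S' :
  equivalent S S' -> translation_type S = translation_type S'.
Proof.
move=> eqS; have [le1 le2 le3] := equivalent_translation_le eqS.
have [ge1 ge2 ge3] := equivalent_translation_le (equivalent_sym eqS).
by congr (_, _, _); apply/eqP; rewrite eqn_leq ?le1 ?le2 ?le3.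
Qed.

Lemma translations_normal_form v1 v2 a u1 u2 w y x : @normal_form n p v1 v2 a u1 u2 w != set0 ->
  ((y, x) \in translations (normal_form v1 v2 a u1 u2 w)) =
  [&& pairing v1 (y *m x) u1 == 0, pairing v2 (y *m x) u2 == 0
    & pairing a (y *m x) (u1 + u2) + pairing (v1 + v2) (y *m x) w == 0].
Proof.
have pD v u (M M' : 'M['F_2]_(n, p)) : pairing v (M + M') u = pairing v M u + pairing v M' u.
  by rewrite /pairing mulmxDr mulmxDl mxE.
have fix1 (t t' : 'F_2) : t = 1 -> (t + t' == 1) = (t' == 0) by move=> ->; case_F2 t'.
have trM M : M \in normal_form v1 v2 a u1 u2 w ->
   (M + y *m x \in normal_form v1 v2 a u1 u2 w) =
  [&& pairing v1 (y *m x) u1 == 0, pairing v2 (y *m x) u2 == 0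
    & pairing a (y *m x) (u1 + u2) + pairing (v1 + v2) (y *m x) w == 0].
  rewrite [M \in _]in_normal_form => /and3P[/eqP e1 /eqP e2 /eqP e3].
  by rewrite in_normal_form !pD addrACA !fix1.
case/set0Pn=> M SM; rewrite inE; apply/forall_inP/idP => [/(_ M SM)|Syx M' SM'].
  by rewrite trM.
by rewrite trM.
Qed.

Definition left_vanishing k : {set 'cV['F_2]_n} :=
  [set y | all (fun i => lcoord y i == 0) (iota 0 k)].
Definition right_vanishing k : {set 'rV['F_2]_p} :=
  [set x | all (fun i => rcoord x i == 0) (iota 0 k)].

Lemma left_vanishing_lt : (3 <= n)%N -> (#|left_vanishing 3| < #|left_vanishing 2|)%N.
Proof.
move=> n3; apply: proper_card; apply/properP; split.
  by apply/subsetP => y; rewrite !inE /= => /and4P[-> ->].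
have [n1 n2] := (ltnW (ltnW n3), ltnW n3).
by exists (std_row n 2)^T; rewrite inE /= !lcoord_std.
Qed.

Lemma right_vanishing_lt : (3 <= p)%N -> (#|right_vanishing 3| < #|right_vanishing 2|)%N.
Proof.
move=> p3; apply: proper_card; apply/properP; split.
  by apply/subsetP => y; rewrite !inE /= => /and4P[-> ->].
have [p1 p2] := (ltnW (ltnW p3), ltnW p3).
by exists (std_row p 2); rewrite inE /= !rcoord_std.
Qed.

Lemma lower_rank_neq0 S r : has_lower_rank r S -> S != set0.
Proof. by case=> -[M SM _] _; apply/set0Pn; exists M. Qed.

Ltac model_translations E H :=
  let S0 := fresh "S0" in have S0 := lower_rank_neq0 (proj2 H);
  rewrite E in S0 *; rewrite (translations_normal_form _ _ S0);
  rewrite ?raddfD !pairingE /= ?addr0 ?add0r !pairing_entry !entry_outer.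

Lemma translations_model_C y x : (2 <= n)%N -> (2 <= p)%N ->
  ((y, x) \in translations (model_C n p)) =
  [&& lcoord y 0 * rcoord x 0 == 0, lcoord y 1 * rcoord x 0 + lcoord y 1 * rcoord x 1 == 0
    & lcoord y 0 * rcoord x 1 + lcoord y 1 * rcoord x 1 == 0].
Proof.
move=> n2 p2; model_translations model_CE (model_C_codim3_rank2 n2 p2).
by case_coords.
Qed.

Lemma translations_model_J y x : (2 <= n)%N -> (2 <= p)%N ->
  ((y, x) \in translations (model_J n p)) =
  [&& lcoord y 0 * rcoord x 0 == 0, lcoord y 1 * rcoord x 1 == 0
    & lcoord y 1 * rcoord x 0 + lcoord y 1 * rcoord x 1 == 0].
Proof.
move=> n2 p2; model_translations model_JE (model_J_codim3_rank2 n2 p2).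
by case_coords.
Qed.

Lemma translations_model_F2 y x : (2 <= n)%N -> (3 <= p)%N ->
  ((y, x) \in translations (model_F2 n p)) =
  [&& lcoord y 0 * rcoord x 0 + lcoord y 0 * rcoord x 1 == 0,
      lcoord y 1 * rcoord x 1 + lcoord y 1 * rcoord x 2 == 0
    & lcoord y 0 * rcoord x 1 + lcoord y 1 * rcoord x 1 == 0].
Proof.
move=> n2 p3; model_translations model_F2E (model_F2_codim3_rank2 n2 p3).
by case_coords.
Qed.

Lemma translations_model_F2T y x : (3 <= n)%N -> (2 <= p)%N ->
  ((y, x) \in translations (model_F2T n p)) =
  [&& lcoord y 0 * rcoord x 0 + lcoord y 1 * rcoord x 0 == 0,
      lcoord y 1 * rcoord x 1 + lcoord y 2 * rcoord x 1 == 0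
    & lcoord y 1 * rcoord x 0 + lcoord y 1 * rcoord x 1 == 0].
Proof.
move=> n3 p2; model_translations model_F2TE (model_F2T_codim3_rank2 n3 p2).
by case_coords.
Qed.

Lemma translations_model_F3 y x : (3 <= n)%N -> (3 <= p)%N ->
  ((y, x) \in translations (model_F3 n p)) =
  [&& lcoord y 1 * rcoord x 0 + lcoord y 1 * rcoord x 1 == 0,
      lcoord y 1 * rcoord x 1 + lcoord y 2 * rcoord x 1 == 0
    & lcoord y 0 * rcoord x 0 + lcoord y 1 * rcoord x 0 + lcoord y 2 * rcoord x 2 == 0].
Proof.
move=> n3 p3; model_translations model_F3E (model_F3_codim3_rank2 n3 p3).
by case_coords.
Qed.

(** Testing against the first three standard vectors gives one inclusion: each of
    them makes the three equations of the model linear in the other variable. *)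
Ltac right_stabilizer mem := apply/setP; let x := fresh "x" in move=> x; rewrite !inE /=;
  apply/forallP/idP;
  [ let Hx := fresh "Hx" in move=> Hx;
    move: (Hx (std_row n 0)^T) (Hx (std_row n 1)^T) (Hx (std_row n 2)^T);
    rewrite !mem // !lcoord_std //=; by case_coords
  | let Hx := fresh "Hx" in let y := fresh "y" in move=> Hx y; rewrite mem //;
    move: Hx; by case_coords].

Ltac left_stabilizer mem := apply/setP; let y := fresh "y" in move=> y; rewrite !inE /=;
  apply/forallP/idP;
  [ let Hy := fresh "Hy" in move=> Hy;
    move: (Hy (std_row p 0)) (Hy (std_row p 1)) (Hy (std_row p 2));
    rewrite !mem // !rcoord_std //=; by case_coords
  | let Hy := fresh "Hy" in let x := fresh "x" in move=> Hy x; rewrite mem //;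
    move: Hy; by case_coords].

Lemma stabilizers_model_C : (2 <= n)%N -> (2 <= p)%N ->
  left_translations (model_C n p) = left_vanishing 2 /\
  right_translations (model_C n p) = right_vanishing 2.
Proof.
move=> n2 p2; have [n1 p1] := (ltnW n2, ltnW p2); split.
  by left_stabilizer translations_model_C.
by right_stabilizer translations_model_C.
Qed.

Lemma stabilizers_model_J : (2 <= n)%N -> (2 <= p)%N ->
  left_translations (model_J n p) = left_vanishing 2 /\
  right_translations (model_J n p) = right_vanishing 2.
Proof.
move=> n2 p2; have [n1 p1] := (ltnW n2, ltnW p2); split.
  by left_stabilizer translations_model_J.
by right_stabilizer translations_model_J.
Qed.

Lemma stabilizers_model_F2 : (2 <= n)%N -> (3 <= p)%N ->
  left_translations (model_F2 n p) = left_vanishing 2 /\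
  right_translations (model_F2 n p) = right_vanishing 3.
Proof.
move=> n2 p3; have p2 := ltnW p3; have [n1 p1] := (ltnW n2, ltnW p2); split.
  by left_stabilizer translations_model_F2.
by right_stabilizer translations_model_F2.
Qed.

Lemma stabilizers_model_F2T : (3 <= n)%N -> (2 <= p)%N ->
  left_translations (model_F2T n p) = left_vanishing 3 /\
  right_translations (model_F2T n p) = right_vanishing 2.
Proof.
move=> n3 p2; have n2 := ltnW n3; have [n1 p1] := (ltnW n2, ltnW p2); split.
  by left_stabilizer translations_model_F2T.
by right_stabilizer translations_model_F2T.
Qed.

Lemma stabilizers_model_F3 : (3 <= n)%N -> (3 <= p)%N ->
  left_translations (model_F3 n p) = left_vanishing 3 /\
  right_translations (model_F3 n p) = right_vanishing 3.
Proof.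
move=> n3 p3; have [n2 p2] := (ltnW n3, ltnW p3); have [n1 p1] := (ltnW n2, ltnW p2); split.
  by left_stabilizer translations_model_F3.
by right_stabilizer translations_model_F3.
Qed.

(** The additional pair is (e_0, e_1), whose product is J in the upper-left
    corner. *)
Lemma translations_model_C_lt_J : (2 <= n)%N -> (2 <= p)%N ->
  (#|translations (model_C n p)| < #|translations (model_J n p)|)%N.
Proof.
move=> n2 p2; have [n1 p1] := (ltnW n2, ltnW p2).
apply: proper_card; apply/properP; split.
  by apply/subsetP => -[y x]; rewrite translations_model_C //
    translations_model_J //; case_coords.
exists ((std_row n 0)^T, std_row p 1); rewrite ?translations_model_C ?translations_model_J //;
  by rewrite !lcoord_std // !rcoord_std.
Qed.

Lemma codim3_lower_rank2_kind S : codim3_lower_rank2 S -> normal_form_kind S.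
Proof.
case=> codimS rkS; have S0 := lower_rank_neq0 rkS; case: rkS => _ rkS.
have [v1 [v2 [a [u1 [u2 [w [v1nz v2nz fu defS]]]]]]] := normal_form_exists codimS S0 rkS.
by rewrite defS; apply: normal_form_kindP; rewrite -?defS.
Qed.

Lemma exactly_from_type (K : {set 'M['F_2]_(n, p)} -> Prop) s :
    (forall S, S \in s -> K S) ->
    (forall S, K S -> exists2 S', S' \in s & equivalent S S') ->
    uniq (map translation_type s) ->
  exactly_up_to_equivalence K s.
Proof.
move=> sK Ks uniq_s; split=> // i j lti ltj /equivalent_translation_type eq_ij.
apply/eqP; rewrite -(nth_uniq (0, 0, 0)%N _ _ uniq_s) ?size_map //.
by rewrite !(nth_map set0) // eq_ij.
Qed.

(** * The classification in each range of sizes *)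

Lemma exactly_square : (2 <= n)%N -> (2 <= p)%N -> ~~ (3 <= n)%N -> ~~ (3 <= p)%N ->
  exactly_up_to_equivalence (@codim3_lower_rank2 n p) [:: model_C n p; model_J n p].
Proof.
move=> n2 p2 n3 p3; apply: exactly_from_type => [S|S /codim3_lower_rank2_kind kindS|].
- rewrite !inE => /orP[] /eqP->; [exact: model_C_codim3_rank2 | exact: model_J_codim3_rank2].
- case: (normal_form_kind_model n2 p2 kindS) => [eqS|eqS|[p3' _]|[n3' _]].
  + by exists (model_C n p); rewrite ?inE ?eqxx ?orbT.
  + by exists (model_J n p); rewrite ?inE ?eqxx ?orbT.
  + by rewrite p3' in p3.
  by rewrite n3' in n3.
rewrite /= !inE !xpair_eqE ?negb_or !negb_and !andbT.
by rewrite (ltn_eqF (translations_model_C_lt_J n2 p2)) orbT.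
Qed.

Lemma exactly_wide : (2 <= n)%N -> (3 <= p)%N -> ~~ (3 <= n)%N ->
  exactly_up_to_equivalence (@codim3_lower_rank2 n p)
    [:: model_C n p; model_J n p; model_F2 n p].
Proof.
move=> n2 p3 n3; have p2 := ltnW p3.
apply: exactly_from_type => [S|S /codim3_lower_rank2_kind kindS|].
- rewrite !inE => /or3P[] /eqP->;
    [exact: model_C_codim3_rank2 | exact: model_J_codim3_rank2 | exact: model_F2_codim3_rank2].
- case: (normal_form_kind_model n2 p2 kindS) => [eqS|eqS|[_ eqS]|[n3' _]].
  + by exists (model_C n p); rewrite ?inE ?eqxx ?orbT.
  + by exists (model_J n p); rewrite ?inE ?eqxx ?orbT.
  + by exists (model_F2 n p); rewrite ?inE ?eqxx ?orbT.
  by rewrite n3' in n3.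
have [lC rC] := stabilizers_model_C n2 p2; have [lJ rJ] := stabilizers_model_J n2 p2.
have [lF2 rF2] := stabilizers_model_F2 n2 p3.
rewrite /= !inE !xpair_eqE ?negb_or !negb_and !andbT lC rC lJ rJ lF2 rF2.
by rewrite (ltn_eqF (translations_model_C_lt_J n2 p2)) (gtn_eqF (right_vanishing_lt p3)) !orbT.
Qed.

Lemma exactly_tall : (3 <= n)%N -> (2 <= p)%N -> ~~ (3 <= p)%N ->
  exactly_up_to_equivalence (@codim3_lower_rank2 n p)
    [:: model_C n p; model_J n p; model_F2T n p].
Proof.
move=> n3 p2 p3; have n2 := ltnW n3.
apply: exactly_from_type => [S|S /codim3_lower_rank2_kind kindS|].
- rewrite !inE => /or3P[] /eqP->;
    [exact: model_C_codim3_rank2 | exact: model_J_codim3_rank2 | exact: model_F2T_codim3_rank2].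
- case: (normal_form_kind_model n2 p2 kindS) => [eqS|eqS|[p3' _]|[_ [eqS|[p3' _]]]].
  + by exists (model_C n p); rewrite ?inE ?eqxx ?orbT.
  + by exists (model_J n p); rewrite ?inE ?eqxx ?orbT.
  + by rewrite p3' in p3.
  + by exists (model_F2T n p); rewrite ?inE ?eqxx ?orbT.
  by rewrite p3' in p3.
have [lC rC] := stabilizers_model_C n2 p2; have [lJ rJ] := stabilizers_model_J n2 p2.
have [lF2T rF2T] := stabilizers_model_F2T n3 p2.
rewrite /= !inE !xpair_eqE ?negb_or !negb_and !andbT lC rC lJ rJ lF2T rF2T.
by rewrite (ltn_eqF (translations_model_C_lt_J n2 p2)) (gtn_eqF (left_vanishing_lt n3)) !orbT.
Qed.

Lemma exactly_large : (3 <= n)%N -> (3 <= p)%N ->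
  exactly_up_to_equivalence (@codim3_lower_rank2 n p)
    [:: model_C n p; model_J n p; model_F2 n p; model_F2T n p; model_F3 n p].
Proof.
move=> n3 p3; have [n2 p2] := (ltnW n3, ltnW p3).
apply: exactly_from_type => [S|S /codim3_lower_rank2_kind kindS|].
- rewrite !inE => /or4P[|||/orP[]] /eqP->;
    [exact: model_C_codim3_rank2 | exact: model_J_codim3_rank2 | exact: model_F2_codim3_rank2
    | exact: model_F2T_codim3_rank2 | exact: model_F3_codim3_rank2].
- case: (normal_form_kind_model n2 p2 kindS) => [eqS|eqS|[_ eqS]|[_ [eqS|[_ eqS]]]].
  + by exists (model_C n p); rewrite ?inE ?eqxx ?orbT.
  + by exists (model_J n p); rewrite ?inE ?eqxx ?orbT.
  + by exists (model_F2 n p); rewrite ?inE ?eqxx ?orbT.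
  + by exists (model_F2T n p); rewrite ?inE ?eqxx ?orbT.
  by exists (model_F3 n p); rewrite ?inE ?eqxx ?orbT.
have [lC rC] := stabilizers_model_C n2 p2; have [lJ rJ] := stabilizers_model_J n2 p2.
have [lF2 rF2] := stabilizers_model_F2 n2 p3; have [lF2T rF2T] := stabilizers_model_F2T n3 p2.
have [lF3 rF3] := stabilizers_model_F3 n3 p3.
have [lt_l lt_r] := (left_vanishing_lt n3, right_vanishing_lt p3).
rewrite /= !inE !xpair_eqE ?negb_or !negb_and !andbT lC rC lJ rJ lF2 rF2 lF2T rF2T lF3 rF3.
rewrite (ltn_eqF (translations_model_C_lt_J n2 p2)).
by rewrite (gtn_eqF lt_l) (ltn_eqF lt_r) (gtn_eqF lt_r) !orbT.
Qed.

End Translations.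

Lemma corner_ext_full n p (hn : (n <= n)%N) (hp : (p <= p)%N) (X : {set 'M['F_2]_(n, p)}) :
  corner_ext hn hp X = X.
Proof.
apply/setP=> M; rewrite inE; congr (_ \in X).
by apply/matrixP => i j; rewrite mxE; congr (M _ _); apply: val_inj.
Qed.

Theorem theorem7p3 (n p : nat) (n2 : (2 <= n)%N) (p2 : (2 <= p)%N) :
  [/\ (* (i) *)
      forall (n3 : (3 <= n)%N) (p3 : (3 <= p)%N),
        exactly_up_to_equivalence (@codim3_lower_rank2 n p)
          [:: corner_ext n2 p2 (id_line Cmx);
              corner_ext n2 p2 (id_line Jmx);
              corner_ext n2 p3 calF2;
              corner_ext n3 p2 (trset calF2);
              corner_ext n3 p3 calF3],
      (* (ii) *)
      forall n3 : (3 <= n)%N, p = 2%N ->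
        exactly_up_to_equivalence (@codim3_lower_rank2 n p)
          [:: corner_ext n2 p2 (id_line Cmx);
              corner_ext n2 p2 (id_line Jmx);
              corner_ext n3 p2 (trset calF2)],
      (* (iii) *)
      n = 2%N -> forall p3 : (3 <= p)%N,
        exactly_up_to_equivalence (@codim3_lower_rank2 n p)
          [:: corner_ext n2 p2 (id_line Cmx);
              corner_ext n2 p2 (id_line Jmx);
              corner_ext n2 p3 calF2]
    & (* (iv) *)
      exactly_up_to_equivalence (@codim3_lower_rank2 2 2)
        [:: id_line Cmx; id_line Jmx]].
Proof.
split=> [n3 p3|n3 p_eq2|n_eq2 p3|].
- by rewrite corner_C corner_J corner_F2 corner_F2T corner_F3; apply: exactly_large.
- by rewrite corner_C corner_J corner_F2T; apply: exactly_tall; rewrite // p_eq2.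
- by rewrite corner_C corner_J corner_F2; apply: exactly_wide; rewrite // n_eq2.
rewrite -(corner_ext_full (leqnn 2) (leqnn 2) (id_line Cmx)).
rewrite -(corner_ext_full (leqnn 2) (leqnn 2) (id_line Jmx)).
by rewrite corner_C corner_J; apply: exactly_square.
Qed.
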